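(* Let $H$ be a Hopf algebra over a field $\Bbbk$. Let $A$ be a partial $H$-module algebra with system of local units $S=\{e_\lambda\}_{\lambda\in\Lambda}$ and with symmetrical $S$-categorizable partial action, and consider the induced symmetrical partial action of $H$ on $a(\mathcal{C}^S(A))$. Then $\underline{A\#H}$ and $\underline{a(\mathcal{C}^S(A))\#H}$ are Morita equivalent.
   Context: Algebras are associative $\Bbbk$-algebras, not necessarily unital; $\Delta(h)=\sum h_{(1)}\otimes h_{(2)}$. A partial action of $H$ on $A$ is a linear map $\cdot:H\otimes A\to A$ with, for all $a,b\in A$, $h,k\in H$: $1_H\cdot a=a$ and $h\cdot(a(k\cdot b))=\sum(h_{(1)}\cdot a)(h_{(2)}k\cdot b)$; $A$ is then a partial $H$-module algebra. It is symmetrical if also $h\cdot((k\cdot b)a)=\sum(h_{(1)}k\cdot b)(h_{(2)}\cdot a)$. A system of local units of $A$ is a set $S=\{e_\lambda\}_{\lambda\in\Lambda}$ of idempotents such that for every finite $F\subseteq A$ there is $e_\alpha\in S$ with $e_\alpha a=ae_\alpha=a$ for all $a\in F$. The partial action is $S$-categorizable if $H\cdot e_\alpha\subseteq e_\alpha Ae_\alpha$ for every $e_\alpha\in S$; in that case $H\cdot(e_\beta Ae_\alpha)\subseteq e_\beta Ae_\alpha$ for all $\alpha,\beta\in\Lambda$. $\mathcal{C}^S(A)$ is the $\Bbbk$-category with object set $\Lambda$, morphisms from $\alpha$ to $\beta$ given by $e_\beta Ae_\alpha$, and composition the multiplication of $A$. $a(\mathcal{C}^S(A))$ is the algebra of matrices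 indexed by $\Lambda\times\Lambda$ with finitely many nonzero entries, the $(\beta,\alpha)$ entry lying in $e_\beta Ae_\alpha$, under matrix multiplication. The induced partial action on it is entrywise: $h\cdot(a_{\beta\alpha})_{\beta,\alpha}=(h\cdot a_{\beta\alpha})_{\beta,\alpha}$. For a partial $H$-module algebra $R$, $R\#H$ is the vector space $R\otimes H$ with product $(a\#h)(b\#k)=\sum a(h_{(1)}\cdot b)\#h_{(2)}k$, and the partial smash product is the subalgebra $\underline{R\#H}=(R\#H)(R\#1_H)$, spanned by the elements $\sum a(h_{(1)}\cdot b)\#h_{(2)}$. Two idempotent algebras $R,R'$ are Morita equivalent if their categories of unital ($RM=M$) and torsionfree ($\{m\in M:Rm=0\}=0$) left modules are equivalent; equivalently, if there is a strict Morita context (both structure maps surjective) between them with unital bimodules. If $R$ is idempotent so is $\underline{R\#H}$. *)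

(* Defs.v *)
From HB Require Import structures.
From mathcomp Require Import all_boot all_order all_algebra finmap.
From mathcomp Require Import all_classical.

Set Implicit Arguments.
Unset Strict Implicit.
Unset Printing Implicit Defensive.

Import GRing.Theory.

Local Open Scope classical_set_scope.
Local Open Scope ring_scope.
Local Open Scope quotient_scope.

Reserved Notation "V ⊗ W" (at level 35, right associativity).
Reserved Notation "a ** b" (at level 40, left associativity).
Reserved Notation "\tsum_ ( x , y <- t ) E"
  (at level 36, x binder, y binder, t at level 50, E at level 36,
   format "'[' \tsum_ ( x ,  y  <-  t ) '/  '  E ']'").

Definition bilinear_map (k : fieldType) (U V W : lmodType k) (f : U -> V -> W) :=
  (forall v, linear (f^~ v)) /\ (forall u, linear (f u)).

Section UnbundledLinear.
Variables (k : fieldType) (U V : lmodType k) (f : U -> V).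
Hypothesis lf : linear f.

Let F : {linear U -> V} := HB.pack f (GRing.isLinear.Build k U V *:%R f lf).

Lemma lin0 : f 0 = 0. Proof. exact: (raddf0 F). Qed.
Lemma linD u v : f (u + v) = f u + f v. Proof. exact: (raddfD F). Qed.
Lemma linZ a u : f (a *: u) = a *: f u. Proof. by have := lf a u 0; rewrite lin0 !addr0. Qed.
Lemma lin_sum I (r : seq I) (P : pred I) (E : I -> U) :
  f (\sum_(i <- r | P i) E i) = \sum_(i <- r | P i) f (E i).
Proof. exact: (raddf_sum F). Qed.

End UnbundledLinear.

(* The tensor product over k: formal sums of pairs (scalars being absorbed by *)
(* the left factor), two sums being identified when no bilinear map tells     *)
(* them apart. The universal property is [tsumE], [tsum_linear], [tensor_ext].*)
Section Tensor.
Variables (k : fieldType) (V W : lmodType k).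
Implicit Types (s : seq (V * W)).

Definition tensor_equiv s1 s2 : bool :=
  `[< forall (U : lmodType k) (f : V -> W -> U), bilinear_map f ->
      \sum_(p <- s1) f p.1 p.2 = \sum_(p <- s2) f p.1 p.2 >].

Fact tensor_equiv_refl : reflexive tensor_equiv.
Proof. by move=> s; apply/asboolP. Qed.
Fact tensor_equiv_sym : symmetric tensor_equiv.
Proof.
by move=> s t; apply/asboolP/asboolP => h U f hf; rewrite (h U f hf).
Qed.
Fact tensor_equiv_trans : transitive tensor_equiv.
Proof.
move=> s t u /asboolP h1 /asboolP h2; apply/asboolP => U f hf.
by rewrite h1 // h2.
Qed.

Canonical tensor_equiv_rel :=
  EquivRel tensor_equiv tensor_equiv_refl tensor_equiv_sym tensor_equiv_trans.

Definition tensor : Type := {eq_quot tensor_equiv}.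
HB.instance Definition _ := Choice.on tensor.
HB.instance Definition _ := EqQuotient.on tensor.

Definition pure (v : V) (w : W) : tensor := \pi_tensor [:: (v, w)].

(* Sweedler-type sums: if t is the sum of the x_i ⊗ y_i and f is bilinear     *)
(* then tsum f t is the sum of the f x_i y_i, whatever the x_i and y_i.       *)
Definition tsum (U : lmodType k) (f : V -> W -> U) (t : tensor) : U :=
  \sum_(p <- repr t) f p.1 p.2.

Lemma tsum_pi (U : lmodType k) (f : V -> W -> U) s : bilinear_map f ->
  tsum f (\pi_tensor s) = \sum_(p <- s) f p.1 p.2.
Proof.
move=> hf; rewrite /tsum; case: piP => r /eqquotP /asboolP h.
by rewrite (h U f hf).
Qed.

Lemma tsumE (U : lmodType k) (f : V -> W -> U) v w : bilinear_map f ->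
  tsum f (pure v w) = f v w.
Proof. by move=> hf; rewrite tsum_pi // big_seq1. Qed.

Lemma tensor_eqP (t u : tensor) :
  (forall (U : lmodType k) (f : V -> W -> U), bilinear_map f ->
     tsum f t = tsum f u) -> t = u.
Proof.
move=> h; rewrite -[t]reprK -[u]reprK; apply/eqquotP/asboolP => U f hf.
exact: h.
Qed.

Definition tadd (t u : tensor) : tensor := \pi_tensor (repr t ++ repr u).
Definition tscale (a : k) (t : tensor) : tensor :=
  \pi_tensor [seq (a *: p.1, p.2) | p <- repr t].
Definition tzero : tensor := \pi_tensor [::].

Let tsum0 (U : lmodType k) (f : V -> W -> U) : bilinear_map f -> tsum f tzero = 0.
Proof. by move=> hf; rewrite tsum_pi // big_nil. Qed.
Let tsumD (U : lmodType k) (f : V -> W -> U) t u : bilinear_map f ->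
  tsum f (tadd t u) = tsum f t + tsum f u.
Proof. by move=> hf; rewrite tsum_pi // big_cat. Qed.
Let tsumZ (U : lmodType k) (f : V -> W -> U) a t : bilinear_map f ->
  tsum f (tscale a t) = a *: tsum f t.
Proof.
move=> hf; rewrite tsum_pi // big_map scaler_sumr; apply: eq_bigr => -[v w] _ /=.
exact: (linZ (hf.1 w)).
Qed.

Fact taddA : associative tadd.
Proof. by move=> t u v; apply: tensor_eqP => U f hf; rewrite !tsumD // addrA. Qed.
Fact taddC : commutative tadd.
Proof. by move=> t u; apply: tensor_eqP => U f hf; rewrite !tsumD // addrC. Qed.
Fact tadd0 : left_id tzero tadd.
Proof. by move=> t; apply: tensor_eqP => U f hf; rewrite tsumD // tsum0 // add0r. Qed.
Fact taddN : left_inverse tzero (tscale (-1)) tadd.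
Proof.
move=> t; apply: tensor_eqP => U f hf.
by rewrite tsumD // tsumZ // tsum0 // scaleN1r addNr.
Qed.

HB.instance Definition _ := GRing.isZmodule.Build tensor taddA taddC tadd0 taddN.

Fact tscaleA a b t : tscale a (tscale b t) = tscale (a * b) t.
Proof. by apply: tensor_eqP => U f hf; rewrite !tsumZ // scalerA. Qed.
Fact tscale1 : left_id 1 tscale.
Proof. by move=> t; apply: tensor_eqP => U f hf; rewrite !tsumZ // scale1r. Qed.
Fact tscaleDr : right_distributive tscale +%R.
Proof.
by move=> a t u; apply: tensor_eqP => U f hf; rewrite !(tsumZ, tsumD) // scalerDr.
Qed.
Fact tscaleDl t : {morph tscale^~ t : a b / a + b}.
Proof.
by move=> a b; apply: tensor_eqP => U f hf; rewrite !(tsumZ, tsumD) // scalerDl.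
Qed.

HB.instance Definition _ :=
  GRing.Zmodule_isLmodule.Build k tensor tscaleA tscale1 tscaleDr tscaleDl.

Lemma tsum_linear (U : lmodType k) (f : V -> W -> U) :
  bilinear_map f -> linear (tsum f).
Proof. by move=> hf a t u; rewrite [LHS]tsumD // tsumZ. Qed.

Lemma pure_bilinear : bilinear_map pure.
Proof.
split=> [w a u v | v a u w]; apply: tensor_eqP => U f hf;
  by rewrite tsum_linear // !tsumE // (hf.1, hf.2).
Qed.

Lemma tsum_pure t : t = tsum pure t.
Proof.
apply: tensor_eqP => U f hf.
rewrite [tsum pure t]/tsum (lin_sum (tsum_linear hf)) [LHS]/tsum.
by apply: eq_bigr => p _; rewrite tsumE.
Qed.

Lemma tensor_ext (U : lmodType k) (f g : tensor -> U) : linear f -> linear g ->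
  (forall v w, f (pure v w) = g (pure v w)) -> f =1 g.
Proof.
move=> lf lg fg t; rewrite [t]tsum_pure [tsum _ t]/tsum (lin_sum lf) (lin_sum lg).
by apply: eq_bigr => p _; exact: fg.
Qed.

End Tensor.

Notation "V ⊗ W" := (tensor V W) : type_scope.
Notation "v ⊗ w" := (pure v w) : ring_scope.
Notation "\tsum_ ( x , y <- t ) E" := (tsum (fun x y => E) t) : ring_scope.

Section TensorSums.
Variable k : fieldType.
Implicit Types U V W X : lmodType k.

Lemma eq_tsum U V W (f g : V -> W -> U) (t : V ⊗ W) :
  (forall v w, f v w = g v w) -> tsum f t = tsum g t.
Proof. by move=> fg; apply: eq_bigr => p _; exact: fg. Qed.

Lemma lin_tsum U V W X (G : U -> X) (f : V -> W -> U) (t : V ⊗ W) :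
  linear G -> G (tsum f t) = \tsum_(v, w <- t) G (f v w).
Proof. by move=> lG; rewrite /tsum (lin_sum lG). Qed.

Lemma exchange_tsum U V W V' W' (f : V -> W -> V' -> W' -> U)
    (t : V ⊗ W) (u : V' ⊗ W') :
  \tsum_(v, w <- t) \tsum_(v', w' <- u) f v w v' w' =
  \tsum_(v', w' <- u) \tsum_(v, w <- t) f v w v' w'.
Proof. exact: exchange_big. Qed.

Lemma lin_id U : linear (fun u : U => u).
Proof. by []. Qed.
Lemma lin_comp U V W (g : V -> W) (f : U -> V) :
  linear g -> linear f -> linear (fun u => g (f u)).
Proof. by move=> lg lf a u v; rewrite lf lg. Qed.
Lemma lin_tsum_body U V W X (f : X -> V -> W -> U) (t : V ⊗ W) :
  (forall v w, linear (fun x => f x v w)) -> linear (fun x => tsum (f x) t).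
Proof.
move=> lf a x y; rewrite /tsum scaler_sumr -big_split.
by apply: eq_bigr => p _; exact: lf.
Qed.
Lemma lin_tsum_arg U V W X (f : V -> W -> U) (t : X -> V ⊗ W) :
  bilinear_map f -> linear t -> linear (fun x => tsum f (t x)).
Proof. by move=> /tsum_linear; exact: lin_comp. Qed.
Lemma lin_purel V W X (f : X -> V) (w : W) :
  linear f -> linear (fun x => f x ⊗ w).
Proof. exact: (lin_comp ((pure_bilinear V W).1 w)). Qed.
Lemma lin_purer V W X (f : X -> W) (v : V) :
  linear f -> linear (fun x => v ⊗ f x).
Proof. exact: (lin_comp ((pure_bilinear V W).2 v)). Qed.

End TensorSums.

(* Associative algebras without unit. *)
HB.mixin Record isNuAlg (k : fieldType) A of GRing.Lmodule k A := {
  nmul : A -> A -> A;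
  nmulA : associative nmul;
  nmul_bilinear : bilinear_map nmul
}.

#[short(type="nuAlgType")]
HB.structure Definition NuAlg (k : fieldType) :=
  {A of isNuAlg k A & GRing.Lmodule k A}.

Notation "a ** b" := (nmul a b) : ring_scope.

Definition idempotent_algebra (k : fieldType) (R : nuAlgType k) :=
  forall r : R, exists s : seq (R * R), r = \sum_(p <- s) p.1 ** p.2.

HB.mixin Record isHopf (k : fieldType) H of GRing.Algebra k H := {
  coprod : H -> H ⊗ H;
  counit : H -> k;
  antipode : H -> H;
  coprod_linear : linear coprod;
  counit_linear : linear (counit : H -> k^o);
  antipode_linear : linear antipode;
  coprodA : forall h,
    \tsum_(h1, h2 <- coprod h) \tsum_(h21, h22 <- coprod h2) h1 ⊗ (h21 ⊗ h22) =
    \tsum_(h1, h2 <- coprod h) \tsum_(h11, h12 <- coprod h1) h11 ⊗ (h12 ⊗ h2);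
  counitl : forall h, \tsum_(h1, h2 <- coprod h) (counit h1 *: h2) = h;
  counitr : forall h, \tsum_(h1, h2 <- coprod h) (counit h2 *: h1) = h;
  coprod1 : coprod 1 = 1 ⊗ 1;
  coprodM : forall g h, coprod (g * h) =
    \tsum_(g1, g2 <- coprod g) \tsum_(h1, h2 <- coprod h) (g1 * h1) ⊗ (g2 * h2);
  counit1 : counit 1 = 1;
  counitM : forall g h, counit (g * h) = counit g * counit h;
  antipodel : forall h,
    \tsum_(h1, h2 <- coprod h) (antipode h1 * h2) = (counit h)%:A;
  antipoder : forall h,
    \tsum_(h1, h2 <- coprod h) (h1 * antipode h2) = (counit h)%:A
}.

#[short(type="hopfAlgType")]
HB.structure Definition Hopf (k : fieldType) :=
  {H of isHopf k H & GRing.Algebra k H}.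

(* A linear map H ⊗ A -> A is given by the corresponding bilinear map.        *)
Record partial_action (k : fieldType) (H : hopfAlgType k) (A : nuAlgType k) :=
  PartialAction {
    pact :> H -> A -> A;
    pact_bilinear : bilinear_map pact;
    pact1 : forall a, pact 1 a = a;
    pactM : forall h g a b, pact h (a ** pact g b) =
      \tsum_(h1, h2 <- coprod h) (pact h1 a ** pact (h2 * g) b)
  }.

Definition symmetrical (k : fieldType) (H : hopfAlgType k) (A : nuAlgType k)
    (act : partial_action H A) :=
  forall h g a b, act h (act g b ** a) =
    \tsum_(h1, h2 <- coprod h) (act (h1 * g) b ** act h2 a).

Section LinearityRules.
Variables (k : fieldType).

Lemma lin_nmull (A : nuAlgType k) (X : lmodType k) (f : X -> A) b :
  linear f -> linear (fun x => f x ** b).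
Proof. exact: (lin_comp ((@nmul_bilinear k A).1 b)). Qed.
Lemma lin_nmulr (A : nuAlgType k) (X : lmodType k) (f : X -> A) a :
  linear f -> linear (fun x => a ** f x).
Proof. exact: (lin_comp ((@nmul_bilinear k A).2 a)). Qed.
Lemma lin_mull (A : algType k) (X : lmodType k) (f : X -> A) b :
  linear f -> linear (fun x => f x * b).
Proof. by move=> lf a u v; rewrite lf mulrDl scalerAl. Qed.
Lemma lin_mulr (A : algType k) (X : lmodType k) (f : X -> A) b :
  linear f -> linear (fun x => b * f x).
Proof. by move=> lf a u v; rewrite lf mulrDr scalerAr. Qed.
Lemma lin_coprod (H : hopfAlgType k) (X : lmodType k) (f : X -> H) :
  linear f -> linear (fun x => coprod (f x)).
Proof. exact: (lin_comp (@coprod_linear k H)). Qed.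
Lemma lin_pactl (H : hopfAlgType k) (A : nuAlgType k)
    (act : partial_action H A) (X : lmodType k) (f : X -> H) a :
  linear f -> linear (fun x => act (f x) a).
Proof. exact: (lin_comp ((pact_bilinear act).1 a)). Qed.
Lemma lin_pactr (H : hopfAlgType k) (A : nuAlgType k)
    (act : partial_action H A) (X : lmodType k) (f : X -> A) h :
  linear f -> linear (fun x => act h (f x)).
Proof. exact: (lin_comp ((pact_bilinear act).2 h)). Qed.

End LinearityRules.

Ltac lin := cbn beta; first
  [ exact: lin_id
  | apply: lin_tsum_body => ? ?; lin
  | apply: lin_tsum_arg; [bilin | lin]
  | apply: lin_purel; lin | apply: lin_purer; lin
  | apply: lin_nmull; lin | apply: lin_nmulr; lin
  | apply: lin_mull; lin | apply: lin_mulr; lin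
  | apply: lin_coprod; lin
  | apply: lin_pactl; lin | apply: lin_pactr; lin ]
with bilin := split => ?; lin.

Lemma tsum_coassoc (k : fieldType) (H : hopfAlgType k) (U : lmodType k)
    (F : H -> H -> H -> U) (h : H) :
  (forall y z, linear (fun x => F x y z)) ->
  (forall x z, linear (fun y => F x y z)) ->
  (forall x y, linear (fun z => F x y z)) ->
  \tsum_(h1, h2 <- coprod h) \tsum_(h21, h22 <- coprod h2) F h1 h21 h22 =
  \tsum_(h1, h2 <- coprod h) \tsum_(h11, h12 <- coprod h1) F h11 h12 h2.
Proof.
move=> F1 F2 F3.
have bF x : bilinear_map (F x) by split.
have bG : bilinear_map (fun x t => tsum (F x) t).
  by split=> [t | x]; [apply: lin_tsum_body => v w; exact: F1 | exact: tsum_linear].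
have lG := tsum_linear bG.
have := congr1 (tsum (fun x t => tsum (F x) t)) (coprodA h).
rewrite !(lin_tsum _ _ lG) => e.
have {e} := e; under eq_tsum => h1 h2 do rewrite (lin_tsum _ _ lG).
under [in X in _ = X -> _]eq_tsum => h1 h2 do rewrite (lin_tsum _ _ lG).
under eq_tsum => h1 h2 do under eq_tsum => x y do rewrite tsumE // tsumE //.
under [in X in _ = X -> _]eq_tsum => h1 h2 do
  under eq_tsum => x y do rewrite tsumE // tsumE //.
by [].
Qed.

Section Smash.
Variables (k : fieldType) (H : hopfAlgType k) (R : nuAlgType k).

Definition smash (act : partial_action H R) : Type := R ⊗ H.

Variable act : partial_action H R.
HB.instance Definition _ := GRing.Lmodule.on (smash act).

Definition smash_mul (x y : smash act) : smash act :=
  \tsum_(a, h <- x) \tsum_(b, g <- y) \tsum_(h1, h2 <- coprod h)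
    (a ** act h1 b) ⊗ (h2 * g).

Fact smash_mul_bilinear : bilinear_map smash_mul.
Proof.
split=> [y | x].
  apply: (@tsum_linear k R H _ (fun a h => \tsum_(b, g <- y)
    \tsum_(h1, h2 <- coprod h) (a ** act h1 b) ⊗ (h2 * g))); bilin.
apply: (@lin_tsum_body k _ _ _ _ (fun y a h => \tsum_(b, g <- y)
    \tsum_(h1, h2 <- coprod h) (a ** act h1 b) ⊗ (h2 * g))) => a h; lin.
Qed.

Fact smash_mul_pure a h b g : smash_mul (a ⊗ h) (b ⊗ g) =
  \tsum_(h1, h2 <- coprod h) (a ** act h1 b) ⊗ (h2 * g).
Proof.
rewrite /smash_mul tsumE; last by bilin.
by rewrite tsumE //; bilin.
Qed.

Let smash_ext (U : lmodType k) (f g : smash act -> U) : linear f -> linear g ->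
  (forall a h, f (a ⊗ h) = g (a ⊗ h)) -> f =1 g.
Proof. exact: (@tensor_ext k R H U f g). Qed.

Fact smash_mulA : associative smash_mul.
Proof.
have [lL lR] := smash_mul_bilinear.
move=> x y z; move: x.
apply: smash_ext => [||a h].
- exact: lL.
- by apply: (lin_comp (lL z)); exact: lL.
move: y; apply: smash_ext => [||b g].
- by apply: (lin_comp (lR _)); exact: lL.
- by apply: (lin_comp (lL z)); exact: lR.
move: z; apply: smash_ext => [||c l].
- by apply: (lin_comp (lR _)); exact: lR.
- exact: lR.
rewrite !smash_mul_pure (lin_tsum _ _ (lR _)) (lin_tsum _ _ (lL _)).
under eq_tsum => g1 g2 do rewrite smash_mul_pure.
under [RHS]eq_tsum => h1 h2 do rewrite smash_mul_pure coprodM.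
rewrite exchange_tsum.
pose F g1 g2 x y z := (a ** (act x b ** act (y * g1) c)) ⊗ (z * (g2 * l)) : R ⊗ H.
transitivity (\tsum_(h1, h2 <- coprod h) \tsum_(g1, g2 <- coprod g)
   \tsum_(h11, h12 <- coprod h1) F g1 g2 h11 h12 h2).
  apply: eq_tsum => h1 h2; apply: eq_tsum => g1 g2.
  rewrite pactM; have lf : linear (fun x : R => (a ** x) ⊗ (h2 * (g2 * l)) : R ⊗ H).
    by lin.
  exact: (lin_tsum _ _ lf).
rewrite exchange_tsum.
transitivity (\tsum_(g1, g2 <- coprod g) \tsum_(h1, h2 <- coprod h)
   \tsum_(h21, h22 <- coprod h2) F g1 g2 h1 h21 h22).
  by apply: eq_tsum => g1 g2; rewrite tsum_coassoc // /F => *; lin.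
rewrite exchange_tsum; apply: eq_tsum => h1 h2; rewrite exchange_tsum.
have bP : bilinear_map
   (fun x y => (a ** act h1 b ** act x c) ⊗ (y * l) : R ⊗ H) by bilin.
rewrite (lin_tsum _ _ (tsum_linear bP)); apply: eq_tsum => h21 h22.
rewrite (lin_tsum _ _ (tsum_linear bP)); apply: eq_tsum => g1 g2.
by rewrite tsumE // /F nmulA mulrA.
Qed.

HB.instance Definition _ :=
  isNuAlg.Build k (smash act) smash_mulA smash_mul_bilinear.

(* The subspace (R # H)(R # 1). *)
Definition psmash_pred : {pred smash act} := fun x =>
  `[< exists s : seq (smash act * R),
      x = \sum_(p <- s) p.1 ** (p.2 ⊗ 1 : smash act) >].

Fact psmash_submod_closed : submod_closed psmash_pred.
Proof.
split=> [|c x y /asboolP[s ->] /asboolP[t ->]]; apply/asboolP.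
  by exists [::]; rewrite big_nil.
exists ([seq (c *: p.1, p.2) | p <- s] ++ t).
rewrite big_cat big_map scaler_sumr; congr (_ + _); apply: eq_bigr => p _ /=.
by rewrite (linZ ((@nmul_bilinear k _).1 _)).
Qed.

HB.instance Definition _ :=
  GRing.isSubmodClosed.Build k (smash act) psmash_pred psmash_submod_closed.

Record psmash := PSmash {
  psmash_val :> smash act;
  psmash_valP : psmash_val \in psmash_pred }.

HB.instance Definition _ := [isSub for psmash_val].
HB.instance Definition _ := [Choice of psmash by <:].
HB.instance Definition _ := [SubChoice_isSubLmodule of psmash by <:].

Fact psmash_mul_subproof (x y : psmash) :
  (x : smash act) ** (y : smash act) \in psmash_pred.
Proof.
case: y => y /= /asboolP[s ->]; apply/asboolP.
exists [seq ((x : smash act) ** p.1, p.2) | p <- s].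
rewrite big_map (lin_sum ((@nmul_bilinear k _).2 _)).
by apply: eq_bigr => p _; rewrite nmulA.
Qed.

Definition psmash_mul (x y : psmash) : psmash := PSmash (psmash_mul_subproof x y).

Fact psmash_mulA : associative psmash_mul.
Proof. by move=> x y z; apply: val_inj; exact: nmulA. Qed.
Fact psmash_mul_bilinear : bilinear_map psmash_mul.
Proof.
split=> [y a u v | x a u v]; apply: val_inj => /=;
  by rewrite ((@nmul_bilinear k _).1, (@nmul_bilinear k _).2).
Qed.

HB.instance Definition _ :=
  isNuAlg.Build k psmash psmash_mulA psmash_mul_bilinear.

End Smash.

Section LocalUnits.
Variables (k : fieldType) (A : nuAlgType k) (L : choiceType).

Definition local_units (e : L -> A) :=
  (forall l, e l ** e l = e l) /\
  (forall F : seq A, exists l,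
     {in F, forall a, e l ** a = a /\ a ** e l = a}).

Definition corner (f g : A) : set A := [set f ** a ** g | a in [set: A]].

Definition categorizable (H : hopfAlgType k) (act : partial_action H A)
  (e : L -> A) := forall l h, corner (e l) (e l) (act h (e l)).

Lemma corner_fix (f g a : A) : f ** f = f -> g ** g = g ->
  corner f g a <-> f ** a = a /\ a ** g = a.
Proof.
move=> ff gg; split=> [[b _ <-] | [fa ag]]; last by exists a; rewrite // fa ag.
by split; rewrite -!nmulA ?gg // (nmulA f f) ff.
Qed.

Lemma corner_pact (H : hopfAlgType k) (act : partial_action H A) (e : L -> A) :
  local_units e -> symmetrical act -> categorizable act e ->
  forall b a h x, corner (e b) (e a) x -> corner (e b) (e a) (act h x).
Proof.
move=> [ee _] sy ca b a h x /(corner_fix _ (ee _) (ee _))[ebx xea].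
apply/(corner_fix _ (ee _) (ee _)); split.
  rewrite -{1 2}ebx -{1 2}[x](pact1 act) !pactM.
  have lE : linear (nmul (e b)) := (@nmul_bilinear k A).2 _.
  rewrite (lin_tsum _ _ lE); apply: eq_tsum => h1 h2.
  by rewrite nmulA; have [-> _] := (corner_fix _ (ee b) (ee b)).1 (ca b h1).
rewrite -{1 2}xea -{1 2}[x](pact1 act) !sy.
have lE : linear (nmul^~ (e a)) := (@nmul_bilinear k A).1 _.
rewrite (lin_tsum _ _ lE); apply: eq_tsum => h1 h2.
by rewrite -nmulA; have [_ ->] := (corner_fix _ (ee a) (ee a)).1 (ca a h2).
Qed.

End LocalUnits.

(* The algebra a(C^S(A)): the (b, a) entry of a matrix is a morphism from a   *)
(* to b in C^S(A), that is an element of e_b A e_a.                           *)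
Section MatrixAlgebra.
Variables (k : fieldType) (A : nuAlgType k) (L : choiceType) (e : L -> A).
Implicit Types M N : L -> L -> A.

Definition catmx_pred : {pred L -> L -> A} := fun M =>
  `[< finite_set [set p : L * L | M p.1 p.2 != 0] /\
      forall b a, corner (e b) (e a) (M b a) >].

Lemma finite_suppP M : finite_set [set p : L * L | M p.1 p.2 != 0] <->
  exists X : {fset L}, forall b a, M b a != 0 -> (b \in X) && (a \in X).
Proof.
split=> [/finite_seqP[s es] | [X hX]].
  exists [fset x in map fst s ++ map snd s]%fset => b a nz.
  have bas : (b, a) \in s by have : [set` s] (b, a) by rewrite -es.
  rewrite !(inE, mem_cat); apply/andP; split; apply/orP.
    by left; apply/mapP; exists (b, a).
  by right; apply/mapP; exists (b, a).
apply: (@sub_finite_set _ _ [set` [seq (b, a) | b <- X, a <- X]]).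
  move=> [b a] /= /hX /andP[bX aX].
  by apply/allpairsP; exists (b, a).
by apply/finite_seqP; exists [seq (b, a) | b <- X, a <- X].
Qed.

Let linfctE c M N b a : (c *: M + N) b a = c *: M b a + N b a.
Proof. by []. Qed.

Fact catmx_submod_closed : submod_closed catmx_pred.
Proof.
have l1 (g : A) := (@nmul_bilinear k A).1 g.
have l2 (f : A) := (@nmul_bilinear k A).2 f.
split=> [|c M N /asboolP[/finite_suppP[X hX] cM] /asboolP[/finite_suppP[Y hY] cN]];
  apply/asboolP; split.
- by apply/finite_suppP; exists fset0 => b a; rewrite eqxx.
- by move=> b a; exists 0; rewrite // (lin0 (l2 _)) (lin0 (l1 _)).
- apply/finite_suppP; exists (X `|` Y)%fset => b a; rewrite !inE.
  have [Mz|/hX/andP[-> ->] //] := eqVneq (M b a) 0.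
  have [Nz|/hY/andP[-> ->] //] := eqVneq (N b a) 0; last by rewrite !orbT.
  by rewrite linfctE Mz Nz scaler0 addr0 eqxx.
- move=> b a; have [[x _ xM] [y _ yN]] := (cM b a, cN b a).
  by exists (c *: x + y); rewrite // l2 l1 xM yN.
Qed.

HB.instance Definition _ :=
  GRing.isSubmodClosed.Build k (L -> L -> A) catmx_pred catmx_submod_closed.

Record catmx := CatMx {
  catmx_val :> L -> L -> A;
  catmx_valP : catmx_val \in catmx_pred }.

HB.instance Definition _ := [isSub for catmx_val].
HB.instance Definition _ := [Choice of catmx by <:].
HB.instance Definition _ := [SubChoice_isSubLmodule of catmx by <:].

Lemma catmxP (M N : catmx) : (forall b a, M b a = N b a) -> M = N.
Proof. by move=> MN; apply: val_inj; apply/funext => b; apply/funext => a. Qed.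

Lemma catmx_supp (M : catmx) :
  exists X : {fset L}, forall b a, M b a != 0 -> (b \in X) && (a \in X).
Proof. by have /asboolP[/finite_suppP] := catmx_valP M. Qed.

Definition catmx_mulfun (M N : L -> L -> A) : L -> L -> A :=
  fun c a => \sum_(b \in [set: L]) M c b ** N b a.

Let n0l (x : A) : 0 ** x = 0. Proof. exact: (lin0 ((@nmul_bilinear k A).1 x)). Qed.
Let n0r (x : A) : x ** 0 = 0. Proof. exact: (lin0 ((@nmul_bilinear k A).2 x)). Qed.

Lemma catmx_mulfunE (M : catmx) (X : {fset L}) :
  (forall b a, M b a != 0 -> (b \in X) && (a \in X)) ->
  forall N c a, catmx_mulfun M N c a = \sum_(b <- X) M c b ** N b a.
Proof.
move=> hX N c a; apply: fsbigTE => b; apply: contraNeq => nz.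
have /hX/andP[//] : M c b != 0 by apply: contraNneq nz => ->; rewrite n0l.
Qed.

Fact catmx_mul_subproof (M N : catmx) : catmx_mulfun M N \in catmx_pred.
Proof.
have [X hX] := catmx_supp M; have [Y hY] := catmx_supp N.
apply/asboolP; split.
  apply/finite_suppP; exists (X `|` Y)%fset => c a.
  rewrite (catmx_mulfunE hX) !inE => nz.
  have [b nzb] : exists b, M c b ** N b a != 0.
    apply: contrapT => no; move/eqP: nz; apply; apply: big1 => b _.
    by apply/eqP; apply: contrapT => /negP nb; apply: no; exists b.
  have /hX/andP[-> _] : M c b != 0 by apply: contraNneq nzb => ->; rewrite n0l.
  have /hY/andP[_ ->] : N b a != 0 by apply: contraNneq nzb => ->; rewrite n0r.
  by rewrite orbT.
move=> c a; rewrite (catmx_mulfunE hX).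
have /asboolP[_ cM] := catmx_valP M; have /asboolP[_ cN] := catmx_valP N.
have /choice[x xE] : forall b, exists x, e c ** x ** e a = M c b ** N b a.
  move=> b; have [[y _ <-] [z _ <-]] := (cM c b, cN b a).
  by exists (y ** e b ** (e b ** z)); rewrite !nmulA.
exists (\sum_(b <- X) x b) => //.
rewrite (lin_sum ((@nmul_bilinear k A).2 _)) (lin_sum ((@nmul_bilinear k A).1 _)).
by apply: eq_bigr.
Qed.

Definition catmx_mul (M N : catmx) : catmx := CatMx (catmx_mul_subproof M N).

Fact catmx_mulA : associative catmx_mul.
Proof.
move=> M N P; apply: catmxP => d a /=.
have [X hX] := catmx_supp M; have [Y hY] := catmx_supp N.
have [Z hZ] := catmx_supp (catmx_mul M N).
rewrite (catmx_mulfunE hX) (@catmx_mulfunE (catmx_mul M N) (Z `|` Y)%fset); last first.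
  by move=> c b /hZ/andP[]; rewrite !inE => -> ->.
transitivity (\sum_(b <- X) \sum_(c <- (Z `|` Y)%fset) M d b ** (N b c ** P c a)).
  apply: eq_bigr => b _; rewrite (@catmx_mulfunE N (Z `|` Y)%fset).
    exact: (lin_sum ((@nmul_bilinear k A).2 _)).
  by move=> c b' /hY/andP[]; rewrite !inE => -> ->; rewrite !orbT.
rewrite exchange_big; apply: eq_bigr => c _ /=; rewrite (catmx_mulfunE hX).
rewrite (lin_sum ((@nmul_bilinear k A).1 _)).
by apply: eq_bigr => b _; rewrite nmulA.
Qed.

Fact catmx_mul_bilinear : bilinear_map catmx_mul.
Proof.
split=> [N c M M' | M c N N']; apply: catmxP => d a /=.
  have [X hX] := catmx_supp M; have [X' hX'] := catmx_supp M'.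
  have [Y hY] := catmx_supp (c *: M + M').
  pose Z := (X `|` X' `|` Y)%fset.
  rewrite [LHS](@catmx_mulfunE (c *: M + M') Z); last first.
    by move=> b b' /hY/andP[]; rewrite !inE => -> ->; rewrite !orbT.
  rewrite linfctE.
  rewrite (@catmx_mulfunE M Z); last first.
    by move=> b b' /hX/andP[]; rewrite !inE => -> ->.
  rewrite (@catmx_mulfunE M' Z); last first.
    by move=> b b' /hX'/andP[]; rewrite !inE => -> ->; rewrite !orbT.
  rewrite scaler_sumr -big_split; apply: eq_bigr => b _.
  exact: ((@nmul_bilinear k A).1 _).
have [X hX] := catmx_supp M.
rewrite [RHS]linfctE !(catmx_mulfunE hX) scaler_sumr -big_split; apply: eq_bigr => b _.
exact: ((@nmul_bilinear k A).2 _).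
Qed.

HB.instance Definition _ :=
  isNuAlg.Build k catmx catmx_mulA catmx_mul_bilinear.

End MatrixAlgebra.

Section InducedAction.
Variables (k : fieldType) (H : hopfAlgType k) (A : nuAlgType k) (L : choiceType).
Variables (act : partial_action H A) (e : L -> A).
Hypotheses (eS : local_units e) (act_sym : symmetrical act).
Hypothesis (act_cat : categorizable act e).

Let act0 h : act h 0 = 0.
Proof. exact: (lin0 ((pact_bilinear act).2 h)). Qed.

Fact catmx_act_subproof (h : H) (M : catmx e) :
  (fun b a => act h (M b a)) \in catmx_pred e.
Proof.
have /asboolP[/finite_suppP[X hX] cM] := catmx_valP M.
apply/asboolP; split; last by move=> b a; apply: corner_pact.
apply/(finite_suppP (fun b a => act h (M b a))); exists X => b a nz; apply: hX.
by apply: contraNneq nz => ->; rewrite act0.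
Qed.

Definition catmx_act (h : H) (M : catmx e) : catmx e :=
  CatMx (catmx_act_subproof h M).

Let entry b a (M : catmx e) : A := M b a.

Let entry_linear b a : linear (entry b a).
Proof. by []. Qed.

Fact catmx_act_bilinear : bilinear_map catmx_act.
Proof.
split=> [M c h h' | h c M N]; apply: catmxP => b a.
  exact: ((pact_bilinear act).1 _).
exact: ((pact_bilinear act).2 _).
Qed.

Fact catmx_act1 M : catmx_act 1 M = M.
Proof. by apply: catmxP => b a; exact: pact1. Qed.

Fact catmx_actM h g M N : catmx_act h (M ** catmx_act g N) =
  \tsum_(h1, h2 <- coprod h) (catmx_act h1 M ** catmx_act (h2 * g) N).
Proof.
apply: catmxP => c a; rewrite -/(entry c a (tsum _ _)).
rewrite (lin_tsum _ _ (entry_linear c a)) [LHS]/=.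
have [X hX] := catmx_supp M.
have hX' h1 : forall b a, catmx_act h1 M b a != 0 -> (b \in X) && (a \in X).
  by move=> b a' nz; apply: hX; apply: contraNneq nz => /= ->; rewrite act0.
rewrite (catmx_mulfunE hX) (lin_sum ((pact_bilinear act).2 h)).
under eq_bigr => b _ do rewrite [X in act h (_ ** X)]/= pactM.
rewrite exchange_big /=; apply: eq_bigr => p _.
by rewrite (catmx_mulfunE (@hX' _)).
Qed.

Definition induced_action : partial_action H (catmx e) :=
  PartialAction catmx_act_bilinear catmx_act1 catmx_actM.

Lemma induced_action_symmetrical : symmetrical induced_action.
Proof.
move=> h g M N; apply: catmxP => c a; rewrite -/(entry c a (tsum _ _)).
rewrite (lin_tsum _ _ (entry_linear c a)) [LHS]/=.
have [X hX] := catmx_supp N.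
have hX' h1 : forall b a, catmx_act h1 N b a != 0 -> (b \in X) && (a \in X).
  by move=> b a' nz; apply: hX; apply: contraNneq nz => /= ->; rewrite act0.
rewrite (catmx_mulfunE (@hX' _)) (lin_sum ((pact_bilinear act).2 h)).
under eq_bigr => b _ do rewrite [X in act h (X ** _)]/= act_sym.
rewrite exchange_big /=; apply: eq_bigr => p _.
by rewrite (catmx_mulfunE (@hX' _)).
Qed.

End InducedAction.

Record category := Category {
  obj :> Type;
  hom : obj -> obj -> Type;
  idm : forall x, hom x x;
  comp : forall x y z, hom y z -> hom x y -> hom x z;
  comp1m : forall x y (f : hom x y), comp (idm y) f = f;
  compm1 : forall x y (f : hom x y), comp f (idm x) = f;
  compA : forall w x y z (f : hom y z) (g : hom x y) (h : hom w x),
    comp f (comp g h) = comp (comp f g) h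
}.

Record functor (C D : category) := Functor {
  fobj :> C -> D;
  fmap : forall x y, hom x y -> hom (fobj x) (fobj y);
  fmap1 : forall x, fmap (idm x) = idm (fobj x);
  fmapM : forall x y z (f : hom y z) (g : hom x y),
    fmap (comp f g) = comp (fmap f) (fmap g)
}.

Definition idfunctor (C : category) : functor C C :=
  @Functor C C (fun x => x) (fun x y f => f) (fun=> erefl) (fun _ _ _ _ _ => erefl).

Section CompFunctor.
Variables (C D E : category) (G : functor D E) (F : functor C D).

Fact compfunctor1 x : fmap G (fmap F (idm x)) = idm (G (F x)).
Proof. by rewrite !fmap1. Qed.
Fact compfunctorM x y z (f : hom y z) (g : hom x y) :
  fmap G (fmap F (comp f g)) = comp (fmap G (fmap F f)) (fmap G (fmap F g)).
Proof. by rewrite !fmapM. Qed.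

Definition compfunctor : functor C E :=
  @Functor C E (fun x => G (F x)) (fun x y f => fmap G (fmap F f))
    compfunctor1 compfunctorM.

End CompFunctor.

Record natiso (C D : category) (F G : functor C D) := NatIso {
  niso : forall x, hom (F x) (G x);
  niso_inv : forall x, hom (G x) (F x);
  nisoK : forall x, comp (niso_inv x) (niso x) = idm (F x);
  niso_invK : forall x, comp (niso x) (niso_inv x) = idm (G x);
  niso_nat : forall x y (f : hom x y),
    comp (niso y) (fmap F f) = comp (fmap G f) (niso x)
}.

Definition equivalent_categories (C D : category) :=
  exists (F : functor C D) (G : functor D C),
    inhabited (natiso (compfunctor G F) (idfunctor C)) /\
    inhabited (natiso (compfunctor F G) (idfunctor D)).

Section Modules.
Variables (k : fieldType) (R : nuAlgType k).

(* Unital torsionfree left modules. *)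
Record utmodule := UTModule {
  mcar :> lmodType k;
  mact : R -> mcar -> mcar;
  mact_bilinear : bilinear_map mact;
  mactA : forall r s m, mact (r ** s) m = mact r (mact s m);
  munital : forall m, exists s : seq (R * mcar),
    m = \sum_(p <- s) mact p.1 p.2;
  mtorsionfree : forall m, (forall r, mact r m = 0) -> m = 0
}.

Record mhom (M N : utmodule) := MHom {
  mfun :> M -> N;
  mhom_linear : linear mfun;
  mhom_act : forall r m, mfun (mact r m) = mact r (mfun m)
}.

Lemma mhomP M N (f g : mhom M N) : f =1 g -> f = g.
Proof.
case: f g => [f lf af] [g lg ag] /= /funext fg; move: lf af lg ag.
by rewrite fg => lf af lg ag; congr MHom; exact: Prop_irrelevance.
Qed.

Definition mhom_id M : mhom M M :=
  @MHom M M (fun m => m) (@lin_id k M) (fun _ _ => erefl).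

Fact mhom_comp_act M N P (f : mhom N P) (g : mhom M N) r m :
  f (g (mact r m)) = mact r (f (g m)).
Proof. by rewrite !mhom_act. Qed.

Definition mhom_comp M N P (f : mhom N P) (g : mhom M N) : mhom M P :=
  MHom (lin_comp (@mhom_linear _ _ f) (@mhom_linear _ _ g)) (mhom_comp_act f g).

Fact mhom_comp1m M N (f : mhom M N) : mhom_comp (mhom_id N) f = f.
Proof. exact: mhomP. Qed.
Fact mhom_compm1 M N (f : mhom M N) : mhom_comp f (mhom_id M) = f.
Proof. exact: mhomP. Qed.
Fact mhom_compA M N P Q (f : mhom P Q) (g : mhom N P) (h : mhom M N) :
  mhom_comp f (mhom_comp g h) = mhom_comp (mhom_comp f g) h.
Proof. exact: mhomP. Qed.

Definition utmodules : category :=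
  Category mhom_comp1m mhom_compm1 mhom_compA.

End Modules.

Definition morita_equivalent (k : fieldType) (R R' : nuAlgType k) :=
  [/\ idempotent_algebra R, idempotent_algebra R' &
      equivalent_categories (utmodules R) (utmodules R')].

(* Main.v *)
(* A strict Morita context (R, S, P, Q) with unital bimodules gives            *)
(* equivalences M |-> S Hom_R(P, M) and N |-> R Hom_S(Q, N), with unit         *)
(* m |-> (q |-> (p |-> (p q) m)); using Hom instead of tensor products avoids  *)
(* tensoring over R and S.                                                     *)
(* If an algebra B has local units u_l, then B and the algebra of finite       *)
(* matrices with (b, a) entry in u_b B u_a are linked by such a context, with  *)
(* P the finite rows (entries in B u_l) and Q the finite columns (in u_l B).   *)
(* The elements u_l = e_l # 1 are local units of the partial smash product of  *)
(* A by H, and taking entries identifies the partial smash product of          *)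
(* a(C^S(A)) by H with the matrix algebra of that of A.                        *)
Require Import Defs.
From HB Require Import structures.
From mathcomp Require Import all_boot all_order all_algebra finmap.
From mathcomp Require Import all_classical.

Set Implicit Arguments.
Unset Strict Implicit.
Unset Printing Implicit Defensive.

Import GRing.Theory.

Local Open Scope classical_set_scope.
Local Open Scope ring_scope.

(** * Morita contexts *)

(** Write B for the partial smash product of A by H, and u_l = e_l # 1.

    An algebra B with local units u_l is Morita equivalent to its algebra of finite matrices with
    (b, a) entry in u_b B u_a. Finite rows and finite columns are bimodules, paired by row times
    column and column times row. Both pairings are onto: r = (r u_l) u_l for a suitable l, and a
    matrix is the sum of its columns, the c-th one multiplied by the row whose only entry is u_c
    ([catmx_context]).

    A Morita context with surjective pairings and unital bimodules gives an equivalence of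
    categories ([mc_morita]). The map sending m to q |-> (p |-> (p q) m) is an isomorphism of M onto
    R Hom_S(Q, S Hom_R(P, M)): torsionfreeness makes it injective ([unit_inj]), the compatibility of
    the two pairings makes it surjective ([unit_surj]).

    The u_l are local units of B ([psmash_local_units]): on the left u_l only multiplies
    A-components, and on the right it meets the factors a # 1 in which elements of B end. As the
    induced action is entrywise, taking entries is multiplicative from the partial smash product of
    a(C^S(A)) to the matrices over B ([entsM]). It is injective because an element is the sum of its
    entries put back in place ([emb_ent]). It is surjective because h . e_a lies in e_a A e_a:
    elements of u_b B u_a then have A-components in e_b A e_a, and placing them at (b, a) stays
    inside the partial smash product. *)

Definition sums (X : Type) (V : nmodType) (g : X -> V) (v : V) :=
  exists s : seq X, v = \sum_(x <- s) g x.

Section Sums.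
Variables (V : nmodType) (X I : Type).
Implicit Types (g : X -> V).

Lemma sums_of g x : sums g (g x).
Proof. by exists [:: x]; rewrite big_seq1. Qed.

Lemma sums0 g : sums g 0.
Proof. by exists [::]; rewrite big_nil. Qed.

Lemma sumsD g u v : sums g u -> sums g v -> sums g (u + v).
Proof. by case=> s -> [t ->]; exists (s ++ t); rewrite big_cat. Qed.

Lemma sums_sum g (r : seq I) (F : I -> V) :
  (forall i, sums g (F i)) -> sums g (\sum_(i <- r) F i).
Proof.
by move=> gF; apply: (big_ind (sums g)) => // *; [exact: sums0 | exact: sumsD].
Qed.

End Sums.

(** Used to refine a decomposition: if each summand of v maps to a sum of the required kind, so does
    v. With [G] the identity, only the shape of the summands changes. *)
Lemma sums_lin (k : fieldType) (V W : lmodType k) (X Y : Type)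
    (g : X -> V) (h : Y -> W) (G : V -> W) v :
  linear G -> (forall x, sums h (G (g x))) -> sums g v -> sums h (G v).
Proof. by move=> lG hG [s ->]; rewrite (lin_sum lG); exact: sums_sum. Qed.

(* (r r') p = r (r' p) and (s s') q = s (s' q) are not required: they follow  *)
(* from the surjectivity of the pairings.                                     *)
Record morita_context (k : fieldType) (R S : nuAlgType k) := MoritaContext {
  mcP : lmodType k;
  mcQ : lmodType k;
  lmulP : R -> mcP -> mcP;
  rmulP : mcP -> S -> mcP;
  lmulQ : S -> mcQ -> mcQ;
  rmulQ : mcQ -> R -> mcQ;
  pairPQ : mcP -> mcQ -> R;
  pairQP : mcQ -> mcP -> S;
  lmulP_bilinear : bilinear_map lmulP;
  rmulP_bilinear : bilinear_map rmulP;
  lmulQ_bilinear : bilinear_map lmulQ;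
  rmulQ_bilinear : bilinear_map rmulQ;
  pairPQ_bilinear : bilinear_map pairPQ;
  pairQP_bilinear : bilinear_map pairQP;
  rmulPA : forall p s t, rmulP p (s ** t) = rmulP (rmulP p s) t;
  rmulQA : forall q r t, rmulQ q (r ** t) = rmulQ (rmulQ q r) t;
  bimulP : forall r p s, lmulP r (rmulP p s) = rmulP (lmulP r p) s;
  bimulQ : forall s q r, lmulQ s (rmulQ q r) = rmulQ (lmulQ s q) r;
  pairPQl : forall r p q, pairPQ (lmulP r p) q = r ** pairPQ p q;
  pairPQr : forall p q r, pairPQ p (rmulQ q r) = pairPQ p q ** r;
  pairPQm : forall p s q, pairPQ (rmulP p s) q = pairPQ p (lmulQ s q);
  pairQPl : forall s q p, pairQP (lmulQ s q) p = s ** pairQP q p;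
  pairQPr : forall q p s, pairQP q (rmulP p s) = pairQP q p ** s;
  pairQPm : forall q r p, pairQP (rmulQ q r) p = pairQP q (lmulP r p);
  pairPQP : forall p q p', lmulP (pairPQ p q) p' = rmulP p (pairQP q p');
  pairQPQ : forall q p q', lmulQ (pairQP q p) q' = rmulQ q (pairPQ p q');
  pairPQ_onto : forall r, sums (fun x : mcP * mcQ => pairPQ x.1 x.2) r;
  pairQP_onto : forall s, sums (fun x : mcQ * mcP => pairQP x.1 x.2) s;
  lmulP_unital : forall p, sums (fun x : R * mcP => lmulP x.1 x.2) p;
  rmulQ_unital : forall q, sums (fun x : mcQ * R => rmulQ x.1 x.2) q
}.

Section Unitality.
Variables (k : fieldType) (R S : nuAlgType k) (c : morita_context R S).

(** Write p as a sum of r p', then r as a sum of p'' q, and use (p'' q) p' = p'' (q p'). *)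
Lemma rmulP_unital p : sums (fun x : mcP c * S => rmulP x.1 x.2) p.
Proof.
apply: (@sums_lin k _ _ _ _ _ _ id) (lmulP_unital p) => // -[r {}p] /=.
have lp : linear (fun r => lmulP r p) := (lmulP_bilinear c).1 p.
apply: (sums_lin lp) (pairPQ_onto c r) => -[p' q] /=.
by rewrite pairPQP; exact: (@sums_of _ _ (fun x => _) (_, _)).
Qed.

Lemma lmulQ_unital q : sums (fun x : S * mcQ c => lmulQ x.1 x.2) q.
Proof.
apply: (@sums_lin k _ _ _ _ _ _ id) (rmulQ_unital q) => // -[{}q r] /=.
have lq : linear (fun r => rmulQ q r) := (rmulQ_bilinear c).2 q.
apply: (sums_lin lq) (pairPQ_onto c r) => -[p q'] /=.
by rewrite -pairQPQ; exact: (@sums_of _ _ (fun x => _) (_, _)).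
Qed.

End Unitality.

(** By this symmetry every later statement is proved for one side of the context only. *)
Definition mc_swap (k : fieldType) (R S : nuAlgType k)
    (c : morita_context R S) : morita_context S R :=
  MoritaContext (lmulQ_bilinear c) (rmulQ_bilinear c)
    (lmulP_bilinear c) (rmulP_bilinear c)
    (pairQP_bilinear c) (pairPQ_bilinear c)
    (@rmulQA _ _ _ c) (@rmulPA _ _ _ c) (@bimulQ _ _ _ c) (@bimulP _ _ _ c)
    (@pairQPl _ _ _ c) (@pairQPr _ _ _ c) (@pairQPm _ _ _ c)
    (@pairPQl _ _ _ c) (@pairPQr _ _ _ c) (@pairPQm _ _ _ c)
    (@pairQPQ _ _ _ c) (@pairPQP _ _ _ c) (@pairQP_onto _ _ _ c)
    (@pairPQ_onto _ _ _ c) (@lmulQ_unital _ _ _ c) (@rmulP_unital _ _ _ c).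

Lemma mc_swapK (k : fieldType) (R S : nuAlgType k) (c : morita_context R S) :
  mc_swap (mc_swap c) = c.
Proof. by case: c => *; congr MoritaContext; exact: Prop_irrelevance. Qed.

(** From r = p q and p = r' p' follows r = r' (p' q). *)
Lemma mc_idempotent (k : fieldType) (R S : nuAlgType k) :
  morita_context R S -> idempotent_algebra R.
Proof.
move=> c r.
apply: (@sums_lin k _ _ _ _ _ _ id) (pairPQ_onto c r) => // -[p q] /=.
have lq : linear (fun p => pairPQ p q) := (pairPQ_bilinear c).1 q.
apply: (sums_lin lq) (lmulP_unital p) => -[r' p'] /=.
by rewrite pairPQl; exact: (@sums_of _ _ (fun x => _) (_, _)).
Qed.

(** * The functor M |-> S Hom_R(P, M) *)

Section HomFunctor.
Variables (k : fieldType) (R S : nuAlgType k) (c : morita_context R S).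
Local Notation P := (mcP c).

Section Object.
Variable M : utmodule R.

Record rhom := RHom {
  rhom_fun :> P -> M;
  rhom_linear : linear rhom_fun;
  rhom_act : forall r p, rhom_fun (lmulP r p) = mact r (rhom_fun p)
}.

(** The left action of S on Hom_R(P, M) coming from the right action on P. *)
Definition shift (s : S) (f : P -> M) : P -> M := fun p => f (rmulP p s).

(* Hom_R(P, M) need not be unital: shom is its unital part S Hom_R(P, M).     *)
Definition shom_pred : {pred P -> M} := fun f =>
  `[< sums (fun x : S * rhom => shift x.1 x.2) f >].

Lemma shift_bilinear (f : rhom) : linear (fun s => shift s f).
Proof.
move=> a s t; apply/funext => p; rewrite /shift (rmulP_bilinear c).2.
exact: rhom_linear.
Qed.

Fact shom_submod_closed : submod_closed shom_pred.
Proof.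
split=> [|a f g /asboolP sf /asboolP sg]; apply/asboolP; first exact: sums0.
apply: sumsD sg; apply: (@sums_lin k _ _ _ _ _ _ ( *:%R a)) sf => [|[s h] /=].
  by move=> b u v; rewrite scalerDr !scalerA mulrC.
rewrite -(linZ (shift_bilinear h)).
exact: (@sums_of _ _ (fun x => _) (_, _)).
Qed.

HB.instance Definition _ :=
  GRing.isSubmodClosed.Build k (P -> M) shom_pred shom_submod_closed.

Record shom := SHom {
  shom_val :> P -> M;
  shom_valP : shom_val \in shom_pred }.

HB.instance Definition _ := [isSub for shom_val].
HB.instance Definition _ := [Choice of shom by <:].
HB.instance Definition _ := [SubChoice_isSubLmodule of shom by <:].

Lemma shomP (f g : shom) : f =1 g -> f = g.
Proof. by move=> fg; apply: val_inj; apply/funext. Qed.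

Lemma shom_linear (f : shom) : linear f.
Proof.
case: f => f /= /asboolP[s ->] a p q.
rewrite !(@lin_sum k (P -> M) M (fun f => f _)) // scaler_sumr -big_split.
apply: eq_bigr => -[t h] _ /=; rewrite /shift (rmulP_bilinear c).1.
exact: rhom_linear.
Qed.

Lemma shom_act (f : shom) r p : f (lmulP r p) = mact r (f p).
Proof.
case: f => f /= /asboolP[s ->].
rewrite !(@lin_sum k (P -> M) M (fun f => f _)) //.
rewrite (lin_sum ((mact_bilinear M).2 r)).
by apply: eq_bigr => -[t h] _ /=; rewrite /shift -bimulP rhom_act.
Qed.

Definition shom_rhom (f : shom) := RHom (shom_linear f) (shom_act f).

Fact shift_subproof s (f : rhom) : shift s f \in shom_pred.
Proof. by apply/asboolP; exact: (@sums_of _ _ (fun x => _) (_, _)). Qed.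

Definition shom_shift (s : S) (f : rhom) : shom := SHom (shift_subproof s f).

Definition shom_mact (s : S) (f : shom) : shom := shom_shift s (shom_rhom f).

Fact shom_mact_bilinear : bilinear_map shom_mact.
Proof.
split=> [f a s t | s a f g]; apply: shomP => p //=.
by rewrite /shift (rmulP_bilinear c).2 (shom_linear f).
Qed.

Fact shom_mactA s t f : shom_mact (s ** t) f = shom_mact s (shom_mact t f).
Proof. by apply: shomP => p /=; rewrite /shift /= /shift rmulPA. Qed.

(** In a summand s h the map h is only in Hom_R(P, M). Idempotence of S gives s = t u, and u h does
    lie in S Hom_R(P, M). *)
Fact shom_unital (f : shom) : sums (fun x : S * shom => shom_mact x.1 x.2) f.
Proof.
have [l fE] : exists l : seq (S * rhom), f = \sum_(x <- l) shom_shift x.1 x.2.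
  have /asboolP[l fE] := shom_valP f; exists l; apply: shomP => p.
  rewrite fE (@lin_sum k (P -> M) M (fun f => f p)) //.
  by rewrite (@lin_sum k shom M (fun f => f p)).
rewrite fE; apply: sums_sum => -[s h] /=.
have lh : linear (fun s => shom_shift s h).
  by move=> a t u; apply: val_inj; exact: shift_bilinear.
apply: (sums_lin lh) (mc_idempotent (mc_swap c) s) => -[t u] /=.
have -> : shom_shift (t ** u) h = shom_mact t (shom_shift u h).
  by apply: shomP => p /=; rewrite /shift /= /shift rmulPA.
exact: (@sums_of _ _ (fun x => _) (_, _)).
Qed.

(** P is unital over S, and f (q t) = (t f) q vanishes. *)
Fact shom_torsionfree (f : shom) : (forall s, shom_mact s f = 0) -> f = 0.
Proof.
move=> f0; apply: shomP => p; have [s ->] := rmulP_unital p.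
rewrite (lin_sum (shom_linear f)) big1 // => -[q t] _ /=.
by rewrite -[f _]/(shom_mact t f q) f0.
Qed.

Definition shom_utmodule : utmodule S :=
  UTModule shom_mact_bilinear shom_mactA shom_unital shom_torsionfree.

End Object.

Section Map.
Variables (M N : utmodule R) (g : mhom M N).

Fact shom_map_subproof (f : shom M) : (fun p => g (f p)) \in @shom_pred N.
Proof.
have lG : linear (fun (f : P -> M) p => g (f p)).
  by move=> a u v; apply/funext => p; exact: mhom_linear.
have /asboolP sf := shom_valP f; apply/asboolP.
apply: (sums_lin lG) sf => -[s h] /=.
have gh_act r p : g (h (lmulP r p)) = mact r (g (h p)).
  by rewrite rhom_act mhom_act.
exact: (@sums_of _ _ (fun x : S * rhom N => _)
  (s, RHom (lin_comp (mhom_linear g) (@rhom_linear _ h)) gh_act)).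
Qed.

Definition shom_map_fun (f : shom_utmodule M) : shom_utmodule N :=
  SHom (shom_map_subproof f).

Fact shom_map_linear : linear shom_map_fun.
Proof. by move=> a u v; apply: shomP => p; exact: mhom_linear. Qed.

Fact shom_map_act s f : shom_map_fun (mact s f) = mact s (shom_map_fun f).
Proof. exact: shomP. Qed.

Definition shom_map : mhom (shom_utmodule M) (shom_utmodule N) :=
  MHom shom_map_linear shom_map_act.

End Map.

Fact shom_map1 M : shom_map (mhom_id M) = mhom_id (shom_utmodule M).
Proof. by apply: mhomP => f; exact: shomP. Qed.

Fact shom_mapM M N L (f : mhom N L) (g : mhom M N) :
  shom_map (mhom_comp f g) = mhom_comp (shom_map f) (shom_map g).
Proof. by apply: mhomP => h; exact: shomP. Qed.

Definition shom_functor : functor (utmodules R) (utmodules S) :=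
  @Functor (utmodules R) (utmodules S) shom_utmodule shom_map
    shom_map1 shom_mapM.

End HomFunctor.

Arguments shom_pred {k R S} c M.
Arguments rhom {k R S} c M.

(** * The unit M -> R Hom_S(Q, S Hom_R(P, M)) is an isomorphism *)

Section Unit.
Variables (k : fieldType) (R S : nuAlgType k) (c : morita_context R S).
Local Notation P := (mcP c).
Local Notation Q := (mcQ c).
Local Notation F := (shom_functor c).
Local Notation G := (shom_functor (mc_swap c)).

Section Object.
Variable M : utmodule R.

Let mactl (m : M) : linear (fun r : R => mact r m) := (mact_bilinear M).1 m.
Let mactr (r : R) : linear (fun m : M => mact r m) := (mact_bilinear M).2 r.

Definition eval_rhom (q : Q) (m : M) : rhom c M :=
  @RHom _ _ _ c M (fun p => mact (pairPQ p q) m)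
    (lin_comp (mactl m) ((pairPQ_bilinear c).1 q))
    (fun r p => etrans (congr1 (fun t => mact t m) (pairPQl r p q))
                       (mactA r (pairPQ p q) m)).

(** Since Q is unital over S, take q = s q'; then p (s q') = (p s) q' exhibits the map as s applied
    to an R-linear map. *)
Fact eval_subproof q m : rhom_fun (eval_rhom q m) \in shom_pred c M.
Proof.
have lG : linear (fun (q : Q) (p : P) => mact (pairPQ p q) m : M).
  by move=> a u v; apply/funext => p; rewrite (pairPQ_bilinear c).2 mactl.
apply/asboolP; apply: (sums_lin lG) (lmulQ_unital q) => -[s q'] /=.
have -> : (fun p : P => mact (pairPQ p (lmulQ s q')) m) =
    shift s (eval_rhom q' m).
  by apply/funext => p; rewrite /shift /= pairPQm.
exact: (@sums_of _ _ (fun x => _) (_, _)).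
Qed.

Definition eval (q : Q) (m : M) : F M := SHom (eval_subproof q m).

Lemma eval_linear m : linear (fun q => eval q m).
Proof.
move=> a u v; apply: shomP => p /=.
by rewrite (pairPQ_bilinear c).2 mactl.
Qed.

Lemma eval_act m s q : eval (lmulQ s q) m = mact s (eval q m).
Proof. by apply: shomP => p /=; rewrite /shift /= pairPQm. Qed.

Definition unit_rhom (m : M) : rhom (mc_swap c) (F M) :=
  @RHom _ _ _ (mc_swap c) (F M) (fun q : mcP (mc_swap c) => eval q m)
    (eval_linear m) (eval_act m).

Fact unit_subproof m : rhom_fun (unit_rhom m) \in shom_pred (mc_swap c) (F M).
Proof.
have lG : linear (fun (m : M) (q : Q) => eval q m).
  by move=> a u v; apply/funext => q; apply: shomP => p /=; exact: mactr.
apply/asboolP; apply: (sums_lin lG) (munital m) => -[r m'] /=.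
have -> : (fun q => eval q (mact r m')) =
    @shift _ _ _ (mc_swap c) (F M) r (unit_rhom m').
  by apply: funext => q; apply: shomP => p /=; rewrite -mactA pairPQr.
exact: (@sums_of _ _ (fun x => _) (_, _)).
Qed.

Definition unit_fun (m : M) : G (F M) := SHom (unit_subproof m).

Fact unit_linear : linear unit_fun.
Proof.
by move=> a u v; apply: shomP => q; apply: shomP => p /=; exact: mactr.
Qed.

Fact unit_act r m : unit_fun (mact r m) = mact r (unit_fun m).
Proof.
by apply: shomP => q; apply: shomP => p /=; rewrite -mactA pairPQr.
Qed.

Definition unit_mhom : mhom M (G (F M)) := MHom unit_linear unit_act.

(** If m and n have the same image, m - n is killed by every p q, hence by R. *)
Lemma unit_inj : injective unit_mhom.
Proof.
move=> m n mn; apply/eqP; rewrite -subr_eq0; apply/eqP.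
apply: mtorsionfree => r; have [l ->] := pairPQ_onto c r.
rewrite (lin_sum (mactl _)) big1 // => -[p q] _ /=.
rewrite -scaleN1r addrC mactr scaleN1r addrC.
apply/eqP; rewrite subr_eq0; apply/eqP.
exact: (congr1 (fun f : G (F M) => (f : Q -> F M) q p) mn).
Qed.

(* (p q) f is the evaluation at f q p: by linearity, for q' in Q and p' in P, *)
(* f (q' (p q)) p' = f ((q' p) q) p' = f q (p' (q' p)) = (p' q') f q p.       *)
Lemma unit_surj (f : G (F M)) : exists m, unit_mhom m = f.
Proof.
have eval_lin : linear (fun (m : M) (q : Q) => eval q m).
  by move=> a u v; apply/funext => q; apply: shomP => p /=; exact: mactr.
(* If f is a sum of maps q |-> eval q m_i, additivity makes it the image of the sum of the m_i. *)
suff [l fE] : sums (fun m (q : Q) => eval q m) (f : Q -> F M).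
  exists (\sum_(m <- l) m); apply: val_inj.
  by apply: etrans (esym fE); exact: (lin_sum eval_lin).
have /asboolP sf := shom_valP f.
apply: (@sums_lin k (Q -> F M) _ _ _ _ _ id) sf => // -[r h] /=.
apply: (sums_lin (shift_bilinear h)) (pairPQ_onto c r) => -[p q] /=.
have -> : shift (pairPQ p q) h = fun q' => eval q' ((h q : F M) p).
  apply/funext => q'; rewrite /shift /= -pairQPQ.
  rewrite [LHS](@rhom_act _ _ _ (mc_swap c) _ h); apply: shomP => p' /=.
  by rewrite /shift /= -pairPQP shom_act.
exact: (@sums_of _ _ (fun m (q : Q) => eval q m)).
Qed.

End Object.

Lemma unit_nat (M N : utmodule R) (g : mhom M N) m :
  unit_mhom N (g m) = Defs.fmap G (Defs.fmap F g) (unit_mhom M m) :> G (F N).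
Proof. by apply: shomP => q; apply: shomP => p /=; rewrite mhom_act. Qed.

End Unit.

Lemma mhom_inverse (k : fieldType) (R : nuAlgType k) (M N : utmodule R)
    (f : mhom M N) : injective f -> (forall n, exists m, f m = n) ->
  {g : mhom N M | cancel f g /\ cancel g f}.
Proof.
move=> fI /choice[g gK].
have fK : cancel f g by move=> m; apply: fI; rewrite gK.
have g_linear : linear g.
  by move=> a u v; apply: fI; rewrite mhom_linear !gK.
have g_act r n : g (mact r n) = mact r (g n).
  by apply: fI; rewrite mhom_act !gK.
by exists (MHom g_linear g_act).
Qed.

Lemma mc_natiso (k : fieldType) (R S : nuAlgType k) (c : morita_context R S) :
  inhabited (natiso (compfunctor (shom_functor (mc_swap c)) (shom_functor c))
                    (idfunctor (utmodules R))).
Proof.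
pose inv M := mhom_inverse (@unit_inj _ _ _ c M) (@unit_surj _ _ _ c M).
constructor.
(* The isomorphism runs from the composite to the identity, so its components are the inverses of
   the units. *)
unshelve refine (@NatIso _ _
  (compfunctor (shom_functor (mc_swap c)) (shom_functor c))
  (idfunctor (utmodules R)) (fun M => sval (inv M))
  (fun M => @unit_mhom _ _ _ c M) _ _ _) => [M | M | M N g].
- by apply: mhomP => f; case: (svalP (inv M)) => _; apply.
- by apply: mhomP => m; case: (svalP (inv M)) => + _; apply.
apply: mhomP => f; have [MK KM] := svalP (inv M); have [NK KN] := svalP (inv N).
by rewrite -[f in LHS]KM /= -[RHS]NK; congr (sval (inv N) _); rewrite unit_nat.
Qed.

Theorem mc_morita (k : fieldType) (R S : nuAlgType k) :
  morita_context R S -> morita_equivalent R S.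
Proof.
move=> c; split; [exact: mc_idempotent c | exact: mc_idempotent (mc_swap c) |].
exists (shom_functor c), (shom_functor (mc_swap c)); split.
  exact: mc_natiso.
by have := mc_natiso (mc_swap c); rewrite mc_swapK.
Qed.

(** * Replacing S by an isomorphic algebra *)

Section Transport.
Variables (k : fieldType) (R S T : nuAlgType k) (c : morita_context R S).
Variables (f : T -> S) (g : S -> T).
Hypotheses (lf : linear f) (fM : {morph f : x y / x ** y}).
Hypotheses (fK : cancel f g) (gK : cancel g f).

Let lg : linear g.
Proof. by move=> a u v; apply: (can_inj fK); rewrite lf !gK. Qed.

Definition mc_transport : morita_context R T.
Proof.
apply: (@MoritaContext k R T (mcP c) (mcQ c) (@lmulP _ _ _ c)
  (fun p t => rmulP p (f t)) (fun t q => lmulQ (f t) q) (@rmulQ _ _ _ c)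
  (@pairPQ _ _ _ c) (fun q p => g (pairQP q p))); first exact: lmulP_bilinear.
- split=> [t | p]; first exact: (rmulP_bilinear c).1.
  exact: lin_comp ((rmulP_bilinear c).2 p) lf.
- split=> [q | t]; last exact: (lmulQ_bilinear c).2.
  exact: lin_comp ((lmulQ_bilinear c).1 q) lf.
- exact: rmulQ_bilinear.
- exact: pairPQ_bilinear.
- split=> [p | q]; first exact: lin_comp lg ((pairQP_bilinear c).1 p).
  exact: lin_comp lg ((pairQP_bilinear c).2 q).
- by move=> p s t; rewrite fM rmulPA.
- exact: rmulQA.
- by move=> *; rewrite bimulP.
- by move=> *; rewrite bimulQ.
- exact: pairPQl.
- exact: pairPQr.
- by move=> *; rewrite pairPQm.
- by move=> s q p; apply: (can_inj fK); rewrite fM !gK pairQPl.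
- by move=> q p s; apply: (can_inj fK); rewrite fM !gK pairQPr.
- by move=> *; rewrite pairQPm.
- by move=> *; rewrite gK pairPQP.
- by move=> *; rewrite gK pairQPQ.
- exact: pairPQ_onto.
- move=> t; rewrite -[t]fK; apply: (sums_lin lg) (pairQP_onto c (f t)) => x.
  exact: (@sums_of _ _ (fun x => _) x).
- exact: lmulP_unital.
- exact: rmulQ_unital.
Defined.

End Transport.

(** * Matrices over an algebra with local units *)

Section Dot.
Variables (k : fieldType) (A : nuAlgType k) (L : choiceType).
Implicit Types (p q : L -> A) (M : L -> L -> A).

Lemma nmul0r (a : A) : 0 ** a = 0.
Proof. exact: (lin0 ((@nmul_bilinear k A).1 a)). Qed.
Lemma nmulr0 (a : A) : a ** 0 = 0.
Proof. exact: (lin0 ((@nmul_bilinear k A).2 a)). Qed.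

Definition supported (X : {fset L}) p := forall l, p l != 0 -> l \in X.

(** The sum over the possibly infinite [L] is 0 by convention when infinitely many terms are
    nonzero, so the rules below ask for finite support of a factor. *)
Definition dot p q : A := \sum_(l \in [set: L]) p l ** q l.

Lemma dotEl X p q : supported X p -> dot p q = \sum_(l <- X) p l ** q l.
Proof.
move=> pX; apply: fsbigTE => l; apply: contraNeq => nz; apply: pX.
by apply: contraNneq nz => ->; rewrite nmul0r.
Qed.

Lemma dotEr X p q : supported X q -> dot p q = \sum_(l <- X) p l ** q l.
Proof.
move=> qX; apply: fsbigTE => l; apply: contraNeq => nz; apply: qX.
by apply: contraNneq nz => ->; rewrite nmulr0.
Qed.

Definition finsupp p := exists X, supported X p.

Lemma finsuppW p q : finsupp p -> (forall l, p l = 0 -> q l = 0) -> finsupp q.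
Proof.
move=> [X pX] pq; exists X => l nz; apply: pX.
by apply: contraNneq nz => /pq ->.
Qed.

Lemma finsuppD a p q : finsupp p -> finsupp q -> finsupp (a *: p + q).
Proof.
move=> [X pX] [Y qY]; exists (X `|` Y)%fset => l; rewrite inE.
have [p0|/pX-> //] := eqVneq (p l) 0; have [q0|/qY->] := eqVneq (q l) 0.
  by rewrite -[_ l]/(a *: p l + q l) p0 q0 scaler0 addr0 eqxx.
by rewrite orbT.
Qed.

Lemma dot_linl q : finsupp q -> linear (dot^~ q).
Proof.
move=> [X qX] a p p'; rewrite !(dotEr _ qX) scaler_sumr -big_split.
by apply: eq_bigr => l _; exact: (@nmul_bilinear k A).1.
Qed.

Lemma dot_linr p : finsupp p -> linear (dot p).
Proof.
move=> [X pX] a q q'; rewrite !(dotEl _ pX) scaler_sumr -big_split.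
by apply: eq_bigr => l _; exact: (@nmul_bilinear k A).2.
Qed.

Lemma dotMl a p q : finsupp p -> dot (fun l => a ** p l) q = a ** dot p q.
Proof.
move=> [X pX]; rewrite (dotEl _ pX) (@dotEl X).
  rewrite (lin_sum ((@nmul_bilinear k A).2 a)).
  by apply: eq_bigr => l _; rewrite nmulA.
by move=> l nz; apply: pX; apply: contraNneq nz => ->; rewrite nmulr0.
Qed.

Lemma dotMr p q a : finsupp p -> dot p (fun l => q l ** a) = dot p q ** a.
Proof.
move=> [X pX]; rewrite !(dotEl _ pX) (lin_sum ((@nmul_bilinear k A).1 a)).
by apply: eq_bigr => l _; rewrite nmulA.
Qed.

Lemma dotA p M q : finsupp p -> finsupp q ->
  dot (fun a => dot p (M^~ a)) q = dot p (fun b => dot (M b) q).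
Proof.
move=> [X pX] [Y qY]; rewrite (dotEl _ pX) (dotEr _ qY).
under eq_bigr => a _ do
  rewrite (dotEl _ pX) (lin_sum ((@nmul_bilinear k A).1 (q a))).
rewrite exchange_big /=; apply: eq_bigr => b _.
rewrite (dotEr _ qY) (lin_sum ((@nmul_bilinear k A).2 (p b))).
by apply: eq_bigr => a _; rewrite nmulA.
Qed.

Definition delta l (x : A) : L -> A := fun l' => if l' == l then x else 0.

Lemma finsupp_delta l x : finsupp (delta l x).
Proof.
exists [fset l]%fset => l'; rewrite /delta inE.
by case: (l' == l); rewrite ?eqxx.
Qed.

Lemma dot_deltal l x q : dot (delta l x) q = x ** q l.
Proof.
rewrite (@dotEl [fset l]%fset) ?big_seq_fset1 /delta ?eqxx // => l'.
by rewrite inE; case: (l' == l); rewrite ?eqxx.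
Qed.

End Dot.

(** * The context of finite rows and columns *)

Section MatrixContext.
Variables (k : fieldType) (A : nuAlgType k) (L : choiceType) (u : L -> A).
Hypothesis uS : local_units u.

Let uu l : u l ** u l = u l. Proof. by case: uS. Qed.

Lemma catmx_fix (M : catmx u) b a :
  u b ** M b a = M b a /\ M b a ** u a = M b a.
Proof. by have /asboolP[_ cM] := catmx_valP M; exact/corner_fix. Qed.

Lemma catmx_finr (M : catmx u) b : finsupp (M b).
Proof. by have [X hX] := catmx_supp M; exists X => a /hX/andP[]. Qed.

Lemma catmx_finl (M : catmx u) a : finsupp (fun b => M b a).
Proof. by have [X hX] := catmx_supp M; exists X => b /hX/andP[]. Qed.

(** As u_l is idempotent, being fixed by u_l on the right amounts to lying in A u_l. *)
Definition row_pred : {pred L -> A} := fun p =>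
  `[< finsupp p /\ forall l, p l ** u l = p l >].
Definition col_pred : {pred L -> A} := fun q =>
  `[< finsupp q /\ forall l, u l ** q l = q l >].

Fact finsupp0 : finsupp (0 : L -> A).
Proof. by exists fset0 => l; rewrite eqxx. Qed.

Fact row_submod_closed : submod_closed row_pred.
Proof.
split=> [|a p q /asboolP[sp pu] /asboolP[sq qu]]; apply/asboolP; split=> [|l].
- exact: finsupp0.
- exact: nmul0r.
- exact: finsuppD.
- by rewrite [LHS](@nmul_bilinear k A).1 pu qu.
Qed.

Fact col_submod_closed : submod_closed col_pred.
Proof.
split=> [|a p q /asboolP[sp pu] /asboolP[sq qu]]; apply/asboolP; split=> [|l].
- exact: finsupp0.
- exact: nmulr0.
- exact: finsuppD.
- by rewrite [LHS](@nmul_bilinear k A).2 pu qu.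
Qed.

HB.instance Definition _ :=
  GRing.isSubmodClosed.Build k (L -> A) row_pred row_submod_closed.
HB.instance Definition _ :=
  GRing.isSubmodClosed.Build k (L -> A) col_pred col_submod_closed.

Record rowv := RowV { rowv_val :> L -> A; rowv_valP : rowv_val \in row_pred }.
Record colv := ColV { colv_val :> L -> A; colv_valP : colv_val \in col_pred }.

HB.instance Definition _ := [isSub for rowv_val].
HB.instance Definition _ := [Choice of rowv by <:].
HB.instance Definition _ := [SubChoice_isSubLmodule of rowv by <:].
HB.instance Definition _ := [isSub for colv_val].
HB.instance Definition _ := [Choice of colv by <:].
HB.instance Definition _ := [SubChoice_isSubLmodule of colv by <:].

Implicit Types (p : rowv) (q : colv) (M : catmx u) (r : A).

Lemma rowvP p p' : p =1 p' -> p = p'.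
Proof. by move=> pp; apply: val_inj; apply/funext. Qed.
Lemma colvP q q' : q =1 q' -> q = q'.
Proof. by move=> qq; apply: val_inj; apply/funext. Qed.

Lemma rowv_fin p : finsupp p. Proof. by have /asboolP[] := rowv_valP p. Qed.
Lemma colv_fin q : finsupp q. Proof. by have /asboolP[] := colv_valP q. Qed.
Lemma rowv_fix p l : p l ** u l = p l.
Proof. by have /asboolP[_] := rowv_valP p. Qed.
Lemma colv_fix q l : u l ** q l = q l.
Proof. by have /asboolP[_] := colv_valP q. Qed.

Fact lrow_subproof r p : (fun l => r ** p l) \in row_pred.
Proof.
apply/asboolP; split=> [|l]; last by rewrite -nmulA rowv_fix.
by apply: finsuppW (rowv_fin p) _ => l ->; rewrite nmulr0.
Qed.
Definition lrow r p := RowV (lrow_subproof r p).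

Fact rcol_subproof q r : (fun l => q l ** r) \in col_pred.
Proof.
apply/asboolP; split=> [|l]; last by rewrite nmulA colv_fix.
by apply: finsuppW (colv_fin q) _ => l ->; rewrite nmul0r.
Qed.
Definition rcol q r := ColV (rcol_subproof q r).

Fact rrow_subproof p M : (fun a => dot p (fun b => M b a)) \in row_pred.
Proof.
apply/asboolP; split=> [|a]; last first.
  rewrite -(dotMr _ _ (rowv_fin p)); congr dot; apply/funext => b.
  by have [_ ->] := catmx_fix M b a.
have [X hX] := catmx_supp M; exists X => a; apply: contraR => aX.
rewrite /dot fsbig1 // => b _; have [->|/hX/andP[_]] := eqVneq (M b a) 0.
  exact: nmulr0.
by rewrite (negPf aX).
Qed.
Definition rrow p M := RowV (rrow_subproof p M).

Fact lcol_subproof M q : (fun b => dot (M b) q) \in col_pred.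
Proof.
apply/asboolP; split=> [|b]; last first.
  rewrite -(dotMl _ _ (catmx_finr M b)); congr dot; apply/funext => a.
  by have [-> _] := catmx_fix M b a.
have [X hX] := catmx_supp M; exists X => b; apply: contraR => bX.
rewrite /dot fsbig1 // => a _; have [->|/hX/andP[+ _]] := eqVneq (M b a) 0.
  exact: nmul0r.
by rewrite (negPf bX).
Qed.
Definition lcol M q := ColV (lcol_subproof M q).

Fact outer_subproof q p : (fun b a => q b ** p a) \in catmx_pred u.
Proof.
apply/asboolP; split; last first.
  by move=> b a; apply/corner_fix; rewrite // nmulA colv_fix -nmulA rowv_fix.
have [X qX] := colv_fin q; have [Y pY] := rowv_fin p.
apply/(finite_suppP (fun b a => q b ** p a)).
exists (X `|` Y)%fset => b a nz; rewrite !inE.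
have /qX-> : q b != 0 by apply: contraNneq nz => ->; rewrite nmul0r.
have /pY-> : p a != 0 by apply: contraNneq nz => ->; rewrite nmulr0.
by rewrite orbT.
Qed.
Definition outer q p : catmx u := CatMx (outer_subproof q p).

Lemma lrow_bilinear : bilinear_map lrow.
Proof.
split=> [p a r s | r a p p']; apply: rowvP => l.
  exact: (@nmul_bilinear k A).1.
exact: (@nmul_bilinear k A).2.
Qed.

Lemma rcol_bilinear : bilinear_map rcol.
Proof.
split=> [r a q q' | q a r r']; apply: colvP => l.
  exact: (@nmul_bilinear k A).1.
exact: (@nmul_bilinear k A).2.
Qed.

Lemma rrow_bilinear : bilinear_map rrow.
Proof.
split=> [M a p p' | p a M M']; apply: rowvP => l.
  exact: dot_linl (catmx_finl M l) a p p'.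
exact: dot_linr (rowv_fin p) a _ _.
Qed.

Lemma lcol_bilinear : bilinear_map lcol.
Proof.
split=> [q a M M' | M a q q']; apply: colvP => l.
  exact: dot_linl (colv_fin q) a _ _.
exact: dot_linr (catmx_finr M l) a q q'.
Qed.

Lemma inner_bilinear : bilinear_map (fun p q => dot p q).
Proof.
split=> [q a p p' | p a q q'].
  exact: dot_linl (colv_fin q) a p p'.
exact: dot_linr (rowv_fin p) a q q'.
Qed.

Lemma outer_bilinear : bilinear_map outer.
Proof.
split=> [p a q q' | q a p p']; apply: catmxP => b c.
  exact: (@nmul_bilinear k A).1.
exact: (@nmul_bilinear k A).2.
Qed.

Fact delta_row_subproof l r : delta l (r ** u l) \in row_pred.
Proof.
apply/asboolP; split=> [|l']; first exact: finsupp_delta.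
by rewrite /delta; case: eqP => [->|_]; rewrite ?nmul0r // -nmulA uu.
Qed.
Definition delta_row l r := RowV (delta_row_subproof l r).

Fact delta_col_subproof l r : delta l (u l ** r) \in col_pred.
Proof.
apply/asboolP; split=> [|l']; first exact: finsupp_delta.
by rewrite /delta; case: eqP => [->|_]; rewrite ?nmulr0 // nmulA uu.
Qed.
Definition delta_col l r := ColV (delta_col_subproof l r).

Lemma inner_onto r : sums (fun x : rowv * colv => dot x.1 x.2) r.
Proof.
have [l /(_ r (mem_head _ _))[_ rl]] := (uS.2 [:: r]).
exists [:: (delta_row l r, delta_col l (u l))]; rewrite big_seq1 /=.
by rewrite dot_deltal /delta eqxx uu -nmulA uu rl.
Qed.

Fact column_subproof M a : (fun b => M b a) \in col_pred.
Proof.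
apply/asboolP; split=> [|b]; first exact: catmx_finl.
by have [] := catmx_fix M b a.
Qed.

Lemma outer_onto M : sums (fun x : colv * rowv => outer x.1 x.2) M.
Proof.
have [X hX] := catmx_supp M.
exists [seq (ColV (column_subproof M c), delta_row c (u c)) | c <- X].
rewrite big_map; apply: catmxP => b a.
rewrite [RHS](@lin_sum k (catmx u) A (fun M => M b a)) //=.
(* The row M b times the a-th column of the diagonal matrix of the u_c: summed over {a} it is M b a,
   summed over X it is the sum of outer products. *)
transitivity (dot (M b) (fun c => delta c (u c) a)).
  rewrite (@dotEr _ _ _ [fset a]%fset) ?big_seq_fset1 /delta ?eqxx.
    by have [_ ->] := catmx_fix M b a.
  by move=> c; rewrite inE (eq_sym c); case: (a == c); rewrite ?eqxx.
rewrite (@dotEl _ _ _ X) => [|c /hX/andP[] //].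
by apply: eq_bigr => c _; rewrite uu.
Qed.

Lemma lrow_unital p : sums (fun x : A * rowv => lrow x.1 x.2) p.
Proof.
have [X pX] := rowv_fin p; have [l lE] := uS.2 [seq p a | a <- X].
exists [:: (u l, p)]; rewrite big_seq1; apply: rowvP => a /=.
have [->|/pX aX] := eqVneq (p a) 0; first by rewrite nmulr0.
by have [] := lE _ (map_f p aX).
Qed.

Lemma rcol_unital q : sums (fun x : colv * A => rcol x.1 x.2) q.
Proof.
have [X qX] := colv_fin q; have [l lE] := uS.2 [seq q a | a <- X].
exists [:: (q, u l)]; rewrite big_seq1; apply: colvP => a /=.
have [->|/qX aX] := eqVneq (q a) 0; first by rewrite nmul0r.
by have [] := lE _ (map_f q aX).
Qed.

Definition catmx_context : morita_context A (catmx u).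
Proof.
apply: (MoritaContext lrow_bilinear rrow_bilinear lcol_bilinear rcol_bilinear
  inner_bilinear outer_bilinear _ _ _ _ _ _ _ _ _ _ _ _
  inner_onto outer_onto lrow_unital rcol_unital).
- move=> p M N; apply: rowvP => a /=; apply/esym.
  exact: dotA (rowv_fin p) (catmx_finl N a).
- by move=> q r s; apply: colvP => b; exact: nmulA.
- by move=> r p M; apply: rowvP => a; apply/esym/dotMl/rowv_fin.
- by move=> M q r; apply: colvP => b; apply/dotMr/catmx_finr.
- by move=> r p q; apply/dotMl/rowv_fin.
- by move=> p q r; apply/dotMr/rowv_fin.
- by move=> p M q; apply: dotA (rowv_fin p) (colv_fin q).
- by move=> M q p; apply: catmxP => b a; apply/esym/dotMr/catmx_finr.
- by move=> q p M; apply: catmxP => b a; apply/esym/dotMl/rowv_fin.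
- by move=> q r p; apply: catmxP => b a; rewrite /= nmulA.
- by move=> p q p'; apply: rowvP => a; apply/esym/dotMr/rowv_fin.
- by move=> q p q'; apply: colvP => b; apply/dotMl/rowv_fin.
Defined.

End MatrixContext.

(** * Partial smash products *)

Section TensorMap.
Variables (k : fieldType) (V V' H : lmodType k) (f : V -> V').
Hypothesis lf : linear f.

Definition tmap (t : V ⊗ H) : V' ⊗ H := \tsum_(v, h <- t) f v ⊗ h.

Let tmap_bil : bilinear_map (fun v (h : H) => f v ⊗ h).
Proof.
split=> [h | v]; first exact: lin_comp ((pure_bilinear V' H).1 h) lf.
exact: (pure_bilinear V' H).2.
Qed.

Lemma tmap_linear : linear tmap. Proof. exact: tsum_linear. Qed.

Lemma tmap_pure v h : tmap (v ⊗ h) = f v ⊗ h. Proof. exact: tsumE. Qed.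

End TensorMap.

Section SmashUnits.
Variables (k : fieldType) (H : hopfAlgType k) (A : nuAlgType k).
Variable act : partial_action H A.
Local Notation B := (smash act).

Lemma smash_ext (U : lmodType k) (f g : B -> U) : linear f -> linear g ->
  (forall a h, f (a ⊗ h) = g (a ⊗ h)) -> f =1 g.
Proof. exact: (@tensor_ext k A H U f g). Qed.

Lemma smash_sums (x : B) : x = \sum_(p <- repr x) (p.1 ⊗ p.2 : B).
Proof. exact: tsum_pure. Qed.

Lemma smash_mull (x : B) : linear (fun y : B => y ** x).
Proof. exact: (@nmul_bilinear k B).1. Qed.
Lemma smash_mulr (x : B) : linear (fun y : B => x ** y).
Proof. exact: (@nmul_bilinear k B).2. Qed.

Lemma smash_pureM a h b g : (a ⊗ h : B) ** (b ⊗ g : B) =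
  \tsum_(h1, h2 <- coprod h) ((a ** act h1 b) ⊗ (h2 * g) : B).
Proof. exact: smash_mul_pure. Qed.

Lemma smash_mul1l a b g : (a ⊗ 1 : B) ** (b ⊗ g : B) = (a ** b) ⊗ g :> B.
Proof.
rewrite smash_pureM coprod1 tsumE; last by bilin.
by rewrite pact1 mul1r.
Qed.

Lemma smash_mul1r a h b : (a ⊗ h : B) ** (b ⊗ 1 : B) =
  \tsum_(h1, h2 <- coprod h) ((a ** act h1 b) ⊗ h2 : B).
Proof. by rewrite smash_pureM; apply: eq_tsum => *; rewrite mulr1. Qed.

(** The conclusion is a finite list in A, so that the lists of finitely many elements can be joined
    before one local unit is chosen. *)
Lemma smash_fixl (x : B) : exists s : seq A, forall f,
  {in s, forall a, f ** a = a} -> (f ⊗ 1 : B) ** x = x.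
Proof.
exists [seq p.1 | p <- repr x] => f fs.
rewrite [in LHS](smash_sums x) (lin_sum (smash_mulr _)) [RHS]smash_sums.
apply: eq_big_seq => p xp; rewrite smash_mul1l fs //.
exact: map_f.
Qed.

Lemma smash_fixr (x : B) : x \in @psmash_pred _ _ _ act ->
  exists s : seq A, forall f,
  {in s, forall a, a ** f = a} -> x ** (f ⊗ 1 : B) = x.
Proof.
case/asboolP=> s ->; exists [seq p.2 | p <- s] => f fs.
rewrite (lin_sum (smash_mull _)); apply: eq_big_seq => p sp.
by rewrite -nmulA smash_mul1l fs // map_f.
Qed.

Variables (L : choiceType) (e : L -> A).
Hypothesis eS : local_units e.

Fact psmash_unit_subproof l : (e l ⊗ 1 : B) \in @psmash_pred _ _ _ act.
Proof.
apply/asboolP; exists [:: (e l ⊗ 1 : B, e l)]; rewrite big_seq1.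
by rewrite smash_mul1l eS.1.
Qed.

Definition psmash_unit l : psmash act := PSmash (psmash_unit_subproof l).

Lemma psmash_local_units : local_units psmash_unit.
Proof.
split=> [l | F]; first by apply: val_inj; rewrite /= [LHS]smash_mul1l eS.1.
have [s sP] : exists s : seq A, forall f,
    {in s, forall a, f ** a = a /\ a ** f = a} ->
    {in F, forall x : psmash act, (f ⊗ 1 : B) ** (x : B) = (x : B) /\
                                  (x : B) ** (f ⊗ 1 : B) = (x : B)}.
  elim: F => [|x F [s sP]]; first by exists [::].
  have [s1 s1P] := smash_fixl x; have [s2 s2P] := smash_fixr (psmash_valP x).
  exists (s1 ++ s2 ++ s) => f fP y; rewrite inE => /predU1P[->|yF].
    split; [apply: s1P | apply: s2P] => a sa;
      by have [] := fP a _; rewrite ?mem_cat ?sa ?orbT.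
  by apply: sP yF => a sa; apply: fP; rewrite !mem_cat sa !orbT.
have [l lP] := eS.2 s; exists l => x xF.
by have [lx xl] := sP _ lP x xF; split; apply: val_inj.
Qed.

End SmashUnits.

(** * Entries identify the smash product of matrices with matrices over the smash product *)

Section Entries.
Variables (k : fieldType) (H : hopfAlgType k) (A : nuAlgType k) (L : choiceType).
Variables (act : partial_action H A) (e : L -> A).
Hypotheses (eS : local_units e) (act_sym : symmetrical act).
Hypothesis (act_cat : categorizable act e).
Local Notation act' := (induced_action eS act_sym act_cat).
Local Notation B := (smash act).
Local Notation B' := (smash act').
Local Notation u := (psmash_unit act eS).
Implicit Types (M N : catmx e) (x y : B') (X : {fset L}).

Let ee l : e l ** e l = e l. Proof. by case: eS. Qed.

Definition ent b a : B' -> B := @tmap k (catmx e) A H (fun M => M b a).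

Lemma ent_linear b a : linear (ent b a).
Proof. by apply: (@tmap_linear k (catmx e) A H (fun M => M b a)). Qed.

Lemma ent_pure b a M h : ent b a (M ⊗ h) = M b a ⊗ h.
Proof. by apply: (@tmap_pure k (catmx e) A H (fun M => M b a)). Qed.

Definition mxsupp X (M : L -> L -> A) :=
  forall b a, M b a != 0 -> (b \in X) && (a \in X).

(** A tensor has no canonical expansion, so its support is bounded through some expansion into pure
    tensors; X then bounds the inner index of all products x y. *)
Definition covers X x := exists2 s : seq (catmx e * H),
  x = \sum_(p <- s) (p.1 ⊗ p.2 : B') &
  {in s, forall p : catmx e * H, mxsupp X p.1}.

Lemma coversW X Y x : (X `<=` Y)%fset -> covers X x -> covers Y x.
Proof.
move=> /fsubsetP XY [s xE sP]; exists s => // p sp b a /(sP p sp) /andP[bX aX].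
by rewrite !XY.
Qed.

Lemma covers_ex x : exists X, covers X x.
Proof.
suff [X XP] : exists X, {in repr x, forall p : catmx e * H, mxsupp X p.1}.
  by exists X, (repr x) => //; exact: smash_sums.
elim: (repr x) => [|[M h] s [X XP]]; first by exists fset0.
have [Y YP] := catmx_supp M; exists (Y `|` X)%fset => p.
rewrite inE => /predU1P[->|sp] b a nz; rewrite !inE.
  by case/andP: (YP b a nz) => -> ->.
by case/andP: (XP p sp b a nz) => -> ->; rewrite !orbT.
Qed.

Lemma ent_supp X x b a : covers X x -> ent b a x != 0 -> (b \in X) && (a \in X).
Proof.
move=> [s -> sP]; rewrite (lin_sum (ent_linear b a)); apply: contraNT => ba.
apply/eqP; rewrite big_seq big1 // => p sp; rewrite ent_pure.
have [->|/(sP p sp)] := eqVneq (p.1 b a) 0; last by rewrite (negPf ba).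
exact: lin0 ((pure_bilinear A H).1 _).
Qed.

(** On pure tensors this is the matrix product M (h1 . N), taken entry by entry because the action
    is entrywise. *)
Lemma ent_mul X x y c a : covers X x ->
  ent c a (x ** y) = \sum_(b <- X) ent c b x ** ent b a y.
Proof.
move=> [s -> sP].
rewrite (lin_sum (smash_mull y)) (lin_sum (ent_linear c a)).
under [RHS]eq_bigr => b _ do
  rewrite (lin_sum (ent_linear c b)) (lin_sum (smash_mull _)).
rewrite exchange_big; apply: eq_big_seq => -[M h] /sP /= MX.
move: y; apply: smash_ext => [| v y z | N g].
- exact: lin_comp (ent_linear c a) (smash_mulr _).
- rewrite scaler_sumr -big_split; apply: eq_bigr => b _.
  exact: (lin_comp (smash_mulr _) (ent_linear b a)).
rewrite smash_pureM (lin_tsum _ _ (ent_linear c a)).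
under [RHS]eq_bigr => b _ do rewrite !ent_pure smash_pureM.
rewrite exchange_big; apply: eq_bigr => -[h1 h2] _ /=.
rewrite ent_pure /= (catmx_mulfunE MX).
exact: (lin_sum ((pure_bilinear A H).1 _)).
Qed.

Lemma ent_psmash b a x : x \in @psmash_pred _ _ _ act' ->
  ent b a x \in @psmash_pred _ _ _ act.
Proof.
case/asboolP=> s ->; rewrite (lin_sum (ent_linear b a)); apply: rpred_sum => p _.
have [X Xp] := covers_ex p.1; rewrite (ent_mul _ _ _ Xp).
apply: rpred_sum => c _; rewrite ent_pure; apply/asboolP.
by exists [:: (ent b c p.1, p.2 c a)]; rewrite big_seq1.
Qed.

Lemma ent_fixl b a x : (e b ⊗ 1 : B) ** ent b a x = ent b a x.
Proof.
move: x; apply: smash_ext => [|| M h].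
- exact: lin_comp (smash_mulr _) (ent_linear b a).
- exact: ent_linear.
by rewrite !ent_pure smash_mul1l; have [-> _] := catmx_fix eS M b a.
Qed.

Lemma ent_fixr b a x : x \in @psmash_pred _ _ _ act' ->
  ent b a x ** (e a ⊗ 1 : B) = ent b a x.
Proof.
case/asboolP=> s ->; rewrite (lin_sum (ent_linear b a)) (lin_sum (smash_mull _)).
apply: eq_bigr => p _; have [X Xp] := covers_ex p.1; rewrite (ent_mul _ _ _ Xp).
rewrite (lin_sum (smash_mull _)); apply: eq_bigr => c _.
by rewrite ent_pure -nmulA smash_mul1l; have [_ ->] := catmx_fix eS p.2 c a.
Qed.

Definition psmash_ent (x : psmash act') b a : psmash act :=
  PSmash (ent_psmash b a (psmash_valP x)).

Fact ents_subproof (x : psmash act') : psmash_ent x \in catmx_pred u.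
Proof.
apply/asboolP; split; last first.
  move=> b a; apply/corner_fix; try exact: (psmash_local_units _ eS).1.
  by split; apply: val_inj; [exact: ent_fixl | exact: ent_fixr (psmash_valP x)].
have [X Xx] := covers_ex x; apply/finite_suppP; exists X => b a nz.
apply: (ent_supp Xx); apply: contraNneq nz => x0; apply/eqP; exact: val_inj.
Qed.

Definition ents (x : psmash act') : catmx u := CatMx (ents_subproof x).

Lemma ents_linear : linear ents.
Proof.
by move=> c x y; apply: catmxP => b a; apply: val_inj; exact: ent_linear.
Qed.

Lemma psmash_val_sum (r : seq L) (F : L -> psmash act) :
  val (\sum_(i <- r) F i) = \sum_(i <- r) val (F i).
Proof. by apply: (@lin_sum k (psmash act) B val). Qed.

Lemma entsM : {morph ents : x y / x ** y}.
Proof.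
move=> x y; apply: catmxP => c a; apply: val_inj.
have [X Xx] := covers_ex x; rewrite [LHS](ent_mul _ _ _ Xx) /=.
rewrite (@catmx_mulfunE _ _ _ u (ents x) X) ?psmash_val_sum // => b d nz.
by apply: (ent_supp Xx); apply: contraNneq nz => x0; apply/eqP; exact: val_inj.
Qed.

Fact mx_unit_subproof b a (v : A) :
  (fun b' a' => if (b' == b) && (a' == a) then e b ** v ** e a else 0)
    \in catmx_pred e.
Proof.
apply/asboolP; split=> [|d c].
  apply/(finite_suppP (fun b' a' =>
    if (b' == b) && (a' == a) then e b ** v ** e a else 0)).
  exists [fset b; a]%fset => d c; rewrite !inE.
  by case: (d == b); case: (c == a); rewrite ?orbT ?eqxx.
apply/corner_fix => //; case: ifP => [/andP[/eqP-> /eqP->]|_]; split.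
- by rewrite !nmulA ee.
- by rewrite -nmulA ee.
- exact: nmulr0.
- exact: nmul0r.
Qed.

(** Compressing v to e_b v e_a makes this a linear map on all of A, hence one that extends to
    tensors. *)
Definition mx_unit b a v : catmx e := CatMx (mx_unit_subproof b a v).

Lemma mx_unit_linear b a : linear (mx_unit b a).
Proof.
move=> r v w; apply: catmxP => d c /=.
rewrite -[RHS]/(r *: mx_unit b a v d c + mx_unit b a w d c) /=.
case: ifP => _; last by rewrite scaler0 addr0.
by rewrite (@nmul_bilinear k A).2 (@nmul_bilinear k A).1.
Qed.

Definition emb b a : B -> B' := @tmap k A (catmx e) H (mx_unit b a).

Lemma emb_linear b a : linear (emb b a).
Proof. by apply: (@tmap_linear k A (catmx e) H); exact: mx_unit_linear. Qed.

Lemma emb_pure b a v h : emb b a (v ⊗ h) = mx_unit b a v ⊗ h.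
Proof. by apply: (@tmap_pure k A (catmx e) H); exact: mx_unit_linear. Qed.

Lemma sum_unit (V : nmodType) X (F : L -> L -> V) d c :
  \sum_(b <- X) \sum_(a <- X) (if (d == b) && (c == a) then F b a else 0) =
  if (d \in X) && (c \in X) then F d c else 0.
Proof.
have sum1 (G : L -> V) i : \sum_(j <- X) (if i == j then G j else 0) =
    if i \in X then G i else 0.
  case: ifP => iX.
    rewrite (bigD1_seq i) ?fset_uniq //= eqxx big1 ?addr0 // => j.
    by rewrite eq_sym => /negPf->.
  by rewrite big_seq big1 // => j jX; case: eqP => // ij; rewrite ij jX in iX.
transitivity (\sum_(b <- X)
    if d == b then if c \in X then F b c else 0 else 0).
  by apply: eq_bigr => b _; case: (d == b) => /=; rewrite ?sum1 ?big1.
by rewrite sum1; case: (d \in X).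
Qed.

Lemma emb_ent X x : covers X x ->
  x = \sum_(b <- X) \sum_(a <- X) emb b a (ent b a x).
Proof.
move=> [s xE sP].
under eq_bigr => b _ do under eq_bigr => a _ do
  rewrite [in X in emb _ _ X]xE (lin_sum (ent_linear b a))
    (lin_sum (emb_linear b a)).
under eq_bigr => b _ do rewrite exchange_big.
rewrite exchange_big {1}xE; apply: eq_big_seq => -[M h] /sP /= MX.
under eq_bigr => b _ do under eq_bigr => a _ do rewrite ent_pure emb_pure.
under eq_bigr => b _ do rewrite -(lin_sum ((pure_bilinear (catmx e) H).1 h)).
rewrite -(lin_sum ((pure_bilinear (catmx e) H).1 h)); congr (_ ⊗ _).
apply: catmxP => d c.
rewrite (@lin_sum k (catmx e) A (fun M => M d c)) //.
under eq_bigr => b _ do rewrite (@lin_sum k (catmx e) A (fun M => M d c)) //.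
under eq_bigr => b _ do under eq_bigr => a _ do
  rewrite /= (catmx_fix eS M b a).1 (catmx_fix eS M b a).2.
rewrite (sum_unit _ (fun b a => M b a)).
have [->|/MX-> //] := eqVneq (M d c) 0; by case: ifP.
Qed.

Lemma ents_inj : injective ents.
Proof.
move=> x y xy; apply: val_inj.
have [X Xx] := covers_ex x; have [Y Yy] := covers_ex y.
rewrite /= (emb_ent (coversW (fsubsetUl X Y) Xx)).
rewrite [RHS](emb_ent (coversW (fsubsetUr X Y) Yy)).
apply: eq_bigr => b _; apply: eq_bigr => a _; congr emb.
exact: (congr1 (fun M : catmx u => val (M b a)) xy).
Qed.

(** Here categorizability enters surjectivity: right multiplication by e_a # 1 in the smash product
    produces factors h1 . e_a, which the compression in [mx_unit] must leave unchanged. *)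
Let act_fix a h : e a ** act h (e a) = act h (e a) /\
                  act h (e a) ** e a = act h (e a).
Proof. exact: (corner_fix _ (ee a) (ee a)).1 (act_cat a h). Qed.

(* If y (e_a # 1) = y, this puts emb b a y in (a(C) # H)(a(C) # 1).           *)
Lemma emb_mulr b a (y : B) : emb b a (y ** (e a ⊗ 1 : B)) =
  emb b a y ** (mx_unit a a (e a) ⊗ 1 : B').
Proof.
move: y; apply: smash_ext => [|| v h].
- exact: lin_comp (emb_linear b a) (smash_mull _).
- exact: lin_comp (smash_mull _) (emb_linear b a).
rewrite emb_pure !smash_mul1r (lin_tsum _ _ (emb_linear b a)).
apply: eq_tsum => h1 h2; rewrite emb_pure; congr (_ ⊗ _).
apply: catmxP => d c /=.
(* Row b of the first factor has a single possibly nonzero entry, at a, and all its other rows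
   vanish. *)
have -> : catmx_mulfun (mx_unit b a v) (catmx_act eS act_sym act_cat h1
   (mx_unit a a (e a))) d c = if d == b then e b ** v ** e a **
   catmx_act eS act_sym act_cat h1 (mx_unit a a (e a)) a c else 0.
  rewrite /catmx_mulfun /=; case: (d == b) => /=; last first.
    by rewrite fsbig1 // => l _; rewrite nmul0r.
  exact: dot_deltal a (e b ** v ** e a) _.
case: (d == b) => //=; rewrite eqxx /=; case: (c == a); last first.
  by rewrite (lin0 ((pact_bilinear act).2 _)) nmulr0.
have [la ra] := act_fix a h1.
by rewrite -[RHS]nmulA !ee la -!nmulA ra.
Qed.

(** For y = v # h, z is the sum of the e_b v (h1 . e_a) # h2, whose A-components lie in e_b A e_a by
    [act_fix]; so compression does nothing. *)
Lemma ent_emb b a d c (y : B) :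
  let z := (e b ⊗ 1 : B) ** y ** (e a ⊗ 1 : B) in
  ent d c (emb b a z) = if (d == b) && (c == a) then z else 0.
Proof.
pose w (y : B) : B := (e b ⊗ 1 : B) ** y ** (e a ⊗ 1 : B); rewrite -/(w y) /=.
have lw : linear w := lin_comp (smash_mull _) (smash_mulr _).
move: y; apply: smash_ext => [| r y z | v h].
- exact: lin_comp (ent_linear d c) (lin_comp (emb_linear b a) lw).
- by case: ifP => _; rewrite ?lw // scaler0 addr0.
rewrite /w smash_mul1l smash_mul1r.
rewrite (lin_tsum _ _ (lin_comp (ent_linear d c) (emb_linear b a))).
have p0 (h' : H) : (0 ⊗ h' : B) = 0 := lin0 ((pure_bilinear A H).1 h').
under eq_tsum => h1 h2 do rewrite emb_pure ent_pure /=.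
case: ifP => _; last by rewrite [LHS]big1.
by apply: eq_tsum => h1 h2; rewrite -!nmulA (act_fix a h1).2 !nmulA ee.
Qed.

Lemma ents_surj (N : catmx u) : exists x : psmash act', ents x = N.
Proof.
have zE b a : (e b ⊗ 1 : B) ** (N b a : B) ** (e a ⊗ 1 : B) = N b a :> B.
  have [Nl Nr] := catmx_fix (psmash_local_units act eS) N b a.
  by rewrite -[in RHS]Nr -{2}Nl.
have embP b a : emb b a (N b a) \in @psmash_pred _ _ _ act'.
  apply/asboolP.
  (* N b a = y (e_a # 1) with y = (e_b # 1) N b a, so [emb_mulr] turns the factor e_a # 1 into a
     final factor of the required form. *)
  exists [:: (emb b a ((e b ⊗ 1 : B) ** (N b a : B)), mx_unit a a (e a))].
  by rewrite big_seq1 -emb_mulr zE.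
have [X NX] := catmx_supp N.
exists (\sum_(b <- X) \sum_(a <- X) PSmash (embP b a)).
apply: catmxP => d c; apply: val_inj => /=.
transitivity (\sum_(b <- X) \sum_(a <- X) ent d c (emb b a (N b a))).
  have lF : linear (fun x : psmash act' => ent d c x).
    by move=> r x y; exact: ent_linear.
  rewrite (lin_sum lF); apply: eq_bigr => b _; exact: (lin_sum lF).
under eq_bigr => b _ do under eq_bigr => a _ do rewrite -zE ent_emb zE.
rewrite (sum_unit _ (fun b a => N b a : B)).
have [->|/NX-> //] := eqVneq (N d c) 0; by case: ifP.
Qed.

End Entries.

Theorem corollary84 (k : fieldType) (H : hopfAlgType k) (A : nuAlgType k)
  (act : partial_action H A) (L : choiceType) (e : L -> A)
  (eS : local_units e) (act_sym : symmetrical act)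
  (act_cat : categorizable act e) :
  morita_equivalent (psmash act) (psmash (induced_action eS act_sym act_cat)).
Proof.
have [g gK] := choice (@ents_surj _ _ _ _ act e eS act_sym act_cat).
have fK := inj_can_sym gK (@ents_inj _ _ _ _ act e eS act_sym act_cat).
apply: mc_morita; apply: mc_transport fK gK.
- exact: catmx_context (psmash_local_units act eS).
- exact: ents_linear.
- exact: entsM.
Qed.
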